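(* Let $\Phi:X\times\mathbb{R}\to X$ be a continuous flow on a compact, locally path connected metric space $X$, with chain recurrent set $R=R(\Phi)$. Any Čech cohomology class $\xi\in\check H^1(X;\mathbb{R})$ satisfying $\xi|_R=0$ contains a Lyapunov one-form $\omega$ for $(\Phi,R)$.
   Context: Write $x\cdot t=\Phi(x,t)$ and let $d$ be the metric of $X$. Closed one-forms. A continuous closed one-form $\omega$ on $X$ is given by an open cover $\mathcal U$ of $X$ and continuous functions $\varphi_U:U\to\mathbb{R}$, $U\in\mathcal U$, such that for all $U,V\in\mathcal U$ the difference $\varphi_U|_{U\cap V}-\varphi_V|_{U\cap V}$ is locally constant (constant on each connected component of $U\cap V$); two such families are identified if their union again satisfies this condition. A continuous function $f$ defines the one-form $df$ (the family consisting of $f$ alone). Forms are restricted to subsets by restricting the functions. For a path $\gamma:[0,1]\to X$, $\int_\gamma\omega=\sum_{i=1}^N\left(\varphi_{U_i}(\gamma(t_i))-\varphi_{U_i}(\gamma(t_{i-1}))\right)$ for any subdivision $0=t_0<\dots<t_N=1$ with $\gamma([t_{i-1},t_i])\subset U_i\in\mathcal U$. The integral $\int_x^{x\cdot t}\omega$ is taken along the trajectory $\tau\mapsto x\cdot\tau$, $\tau\in[0,t]$. Closed one-forms are the global sections of the quotient sheaf $B_X=C_X/\mathbb{R}_X$ (continuous real functions modulo locally constant ones), and $[\omega]\in\check H^1(X;\mathbb{R})=H^1(X;\mathbb{R}_X)$ is the image of $\omega$ under the connecting homomorphism of $0\to\mathbb{R}_X\to C_X\to B_X\to0$. The class $\xi$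 contains $\omega$ if $[\omega]=\xi$. Lyapunov one-form. Let $Y\subset X$ be closed and invariant under $\Phi$. A continuous closed one-form $\omega$ on $X$ is a Lyapunov one-form for $(\Phi,Y)$ if (L1) $\int_x^{x\cdot t}\omega<0$ for every $x\in X-Y$ and $t>0$; and (L2) there is a continuous function $f:U\to\mathbb{R}$ on an open neighborhood $U$ of $Y$ such that $\omega|_U=df$ and $f$ is constant on every connected component of $Y$. Chain recurrent set. A $(\delta,T)$-chain from $x$ to $y$ is a sequence $x_0=x,x_1,\dots,x_N=y$ in $X$ with $t_1,\dots,t_N\in\mathbb{R}$ such that $t_i\ge T$ and $d(x_{i-1}\cdot t_i,x_i)<\delta$ for $1\le i\le N$. $R(\Phi)$ is the set of $x\in X$ such that for all $\delta>0$, $T\ge1$ there is a $(\delta,T)$-chain from $x$ to $x$; it is closed and flow-invariant. *)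

(* Defs.v *)
From HB Require Import structures.
From mathcomp Require Import all_boot all_order all_algebra generic_quotient.
From mathcomp Require Import all_classical all_reals all_analysis.
From mathcomp Require Import ring lra.

(* K : realType is the real line. A function on a subset B of a space T is represented by a total
   function on T whose values off B are irrelevant (as in
   {within B, continuous f}). *)

Set Implicit Arguments.
Unset Strict Implicit.
Unset Printing Implicit Defensive.

Import Order.TTheory GRing.Theory Num.Theory.
Import numFieldNormedType.Exports.

Local Open Scope classical_set_scope.
Local Open Scope ring_scope.
Local Open Scope quotient_scope.

Section LocallyConstant.
Context {K : realType} {T : topologicalType}.
Implicit Types (A B : set T) (f g : T -> K).

(* Sections over B of the constant sheaf: near each point of B, in the subspace
   topology of B, the function is constant. For an open B in a locally path
   connected space this is constancy on the connected components of B, see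
   locally_constantP below. *)
Definition locally_constant B f :=
  forall x, B x -> \forall y \near within B (nbhs x), f y = f x.

Lemma locally_constant_sub A B f :
  A `<=` B -> locally_constant B f -> locally_constant A f.
Proof.
move=> AB lf x Ax; have := lf x (AB _ Ax).
rewrite !near_withinE; apply: filterS => y h Ay; exact: h (AB _ Ay).
Qed.

Lemma locally_constant_ext B f g : (forall x, B x -> f x = g x) ->
  locally_constant B f -> locally_constant B g.
Proof.
move=> fg lf x Bx; have := lf x Bx; rewrite !near_withinE; apply: filterS.
by move=> y h By; rewrite -!fg// h.
Qed.

Lemma locally_constant_cst B (k : K) : locally_constant B (fun=> k).
Proof. by move=> x Bx; exact: nearW. Qed.

Lemma locally_constantB B f g : locally_constant B f -> locally_constant B g ->
  locally_constant B (fun x => f x - g x).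
Proof.
move=> lf lg x Bx; have := lg x Bx; have := lf x Bx; rewrite !near_withinE.
by apply: filterS2 => y hf hg By; rewrite hf// hg.
Qed.

Definition is_open_cover A (C : set (set T)) :=
  (forall U, C U -> open U) /\ A `<=` \bigcup_(U in C) U.

Lemma locally_constant_local B f :
  (forall x, B x -> exists O, [/\ open O, O x & locally_constant (B `&` O) f]) ->
  locally_constant B f.
Proof.
move=> h x Bx; have [W [oO Ox lf]] := h x Bx.
have := lf x (conj Bx Ox).
have nO : nbhs x W := open_nbhs_nbhs (conj oO Ox).
rewrite !near_withinE; apply: filterS2 nO => y Oy hy By; exact: hy.
Qed.

Lemma locally_constant_connected B f : connected B -> locally_constant B f ->
  forall x y, B x -> B y -> f y = f x.
Proof.
move=> cB lf x y Bx By.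
suff : [set z | B z /\ f z = f x] = B by move=> e; move: By; rewrite -e => -[].
apply: cB; first by exists x.
- exists (interior [set z | B z -> f z = f x]); first exact: open_interior.
  apply/seteqP; split=> z /= [Bz fz]; split=> //.
    by have := lf z Bz; rewrite near_withinE; apply: filterS => t + Bt; rewrite -fz; exact.
  exact: (interior_subset fz).
- exists (~` interior [set z | B z -> f z <> f x]).
    exact/open_closedC/open_interior.
  apply/seteqP; split=> z /= [Bz fz]; split=> //.
    by move=> /interior_subset; exact.
  apply: contrapT => nfz; apply: fz.
  have := lf z Bz; rewrite near_withinE; apply: filterS => t + Bt.
  by move=> /(_ Bt) ->.
Qed.

End LocallyConstant.

Section ClosedOneForms.
Context (K : realType) {T : topologicalType}.
Implicit Types A B : set T.

(* The open subsets of A are the traces on A of the open subsets of T, so a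
   cover of A is given by open subsets of T. *)
Record form_family A := FormFamily {
  form_cover : set (set T) ;
  pot : set T -> T -> K ;
  form_coverP : is_open_cover A form_cover ;
  pot_continuous : forall U, form_cover U ->
    {within A `&` U, continuous (pot U)} ;
  pot_compat : forall U V, form_cover U -> form_cover V ->
    locally_constant (A `&` U `&` V) (fun x => pot U x - pot V x) }.

HB.instance Definition _ A := gen_eqMixin (form_family A).
HB.instance Definition _ A := gen_choiceMixin (form_family A).

(* Given that F and G are compatible families, this says that their union is. *)
Definition form_equiv A (F G : form_family A) :=
  forall U V, form_cover F U -> form_cover G V ->
    locally_constant (A `&` U `&` V) (fun x => pot F U x - pot G V x).

Lemma form_equiv_refl A (F : form_family A) : form_equiv F F.
Proof. by move=> U V FU FV; exact: pot_compat. Qed.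

Lemma form_equiv_sym A (F G : form_family A) :
  form_equiv F G -> form_equiv G F.
Proof.
move=> FG U V GU FV.
have := locally_constantB (locally_constant_cst 0) (FG _ _ FV GU).
rewrite setIAC; apply: locally_constant_ext => x _; ring.
Qed.

Lemma form_equiv_trans A (F G H : form_family A) :
  form_equiv F G -> form_equiv G H -> form_equiv F H.
Proof.
move=> FG GH U W FU HW; apply: locally_constant_local => x [[Ax Ux] Wx].
have [Go cG] := form_coverP G; have [V GV Vx] := cG x Ax.
exists V; split=> //; first exact: Go.
have l1 : locally_constant (A `&` U `&` W `&` V) (fun x => pot F U x - pot G V x).
  by apply: locally_constant_sub (FG _ _ FU GV) => y [[[? ?] ?] ?].
have l2 : locally_constant (A `&` U `&` W `&` V) (fun x => 0 - (pot G V x - pot H W x)).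
  apply: locally_constantB; first exact: locally_constant_cst.
  by apply: locally_constant_sub (GH _ _ GV HW) => y [[[? ?] ?] ?].
by apply: locally_constant_ext (locally_constantB l1 l2) => y _; ring.
Qed.

Definition form_equivb A (F G : form_family A) := `[< form_equiv F G >].

Lemma form_equivb_refl A : reflexive (@form_equivb A).
Proof. by move=> F; exact/asboolP/form_equiv_refl. Qed.

Lemma form_equivb_sym A : symmetric (@form_equivb A).
Proof. by move=> F G; apply/idP/idP => /asboolP/form_equiv_sym/asboolP. Qed.

Lemma form_equivb_trans A : transitive (@form_equivb A).
Proof.
by move=> G F H /asboolP FG /asboolP GH; exact/asboolP/(form_equiv_trans FG GH).
Qed.

Canonical form_equiv_rel A := EquivRel (@form_equivb A)
  (@form_equivb_refl A) (@form_equivb_sym A) (@form_equivb_trans A).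

Definition closed_form A := {eq_quot (form_equiv_rel A)}.

Lemma closed_form_eqP A (F G : form_family A) :
  \pi_(closed_form A) F = \pi_(closed_form A) G <-> form_equiv F G.
Proof.
split=> [|h]; first by move=> /eqmodP/asboolP.
by apply/eqmodP; exact/asboolP.
Qed.

Lemma repr_form_equiv A (F : form_family A) :
  form_equiv (repr (\pi_(closed_form A) F)) F.
Proof. by apply/closed_form_eqP; rewrite reprK. Qed.

Lemma is_open_cover_sub A B C :
  B `<=` A -> is_open_cover A C -> is_open_cover B C.
Proof. by move=> BA [oC AC]; split=> // x /BA/AC. Qed.

Section Restriction.
Variables (A B : set T) (BA : B `<=` A).

Lemma family_restr_continuous (F : form_family A) U : form_cover F U ->
  {within B `&` U, continuous (pot F U)}.
Proof.
move=> FU; apply: continuous_subspaceW (pot_continuous FU).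
by apply: setSI.
Qed.

Lemma family_restr_compat (F : form_family A) U V :
  form_cover F U -> form_cover F V ->
  locally_constant (B `&` U `&` V) (fun x => pot F U x - pot F V x).
Proof.
move=> FU FV; apply: locally_constant_sub (pot_compat FU FV).
by move=> x [[/BA]].
Qed.

Definition family_restr (F : form_family A) : form_family B :=
  FormFamily (is_open_cover_sub BA (form_coverP F))
    (@family_restr_continuous F) (@family_restr_compat F).

Definition form_restr (w : closed_form A) : closed_form B :=
  \pi_(closed_form B) (family_restr (repr w)).

Lemma form_restr_pi (F : form_family A) :
  form_restr (\pi_(closed_form A) F) = \pi_(closed_form B) (family_restr F).
Proof.
apply/closed_form_eqP => U V FU FV.
apply: locally_constant_sub (repr_form_equiv FU FV) => x [[/BA Ax Ux] Vx].
by [].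
Qed.

End Restriction.

Section Exact.
Variables (A : set T) (f : T -> K) (fA : {within A, continuous f}).

Lemma is_open_coverT : is_open_cover A [set setT].
Proof.
split=> [U ->|x _]; first exact: openT.
by exists setT.
Qed.

Lemma exact_continuous U : [set setT] U ->
  {within A `&` U, continuous ((fun=> f) U)}.
Proof. by move=> ->; rewrite setIT. Qed.

Lemma exact_compat U V : [set setT] U -> [set setT] V ->
  locally_constant (A `&` U `&` V) (fun x => (fun=> f) U x - (fun=> f) V x).
Proof.
move=> _ _; apply: locally_constant_ext (locally_constant_cst 0) => x _.
by rewrite subrr.
Qed.

Definition exact_form : closed_form A :=
  \pi_(closed_form A)
    (FormFamily is_open_coverT exact_continuous exact_compat).

End Exact.

End ClosedOneForms.

Section LineIntegral.
Context (K : realType) {T : topologicalType}.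
Implicit Types (F : form_family K [set: T]) (g : K -> T).

(* The subdivision a = t_0 < ... < t_N = b is the sequence a :: s. *)
Definition is_line_integral F g (a b v : K) :=
  exists (s : seq K) (U : nat -> set T),
    [/\ itv_partition a b s,
        forall i, (i < size s)%N -> form_cover F (U i) /\
          g @` `[nth b (a :: s) i, nth b (a :: s) i.+1] `<=` U i
      & v = \sum_(i < size s) (pot F (U i) (g (nth b (a :: s) i.+1)) -
                               pot F (U i) (g (nth b (a :: s) i)))].

(* The integral of w along the path g : [a, b] -> T; existence of the value and
   its independence of all choices are line_integral_exists and
   line_integralE. *)
Definition line_integral (w : closed_form K [set: T]) g (a b : K) : K :=
  get (is_line_integral (repr w) g a b).

Lemma is_line_integral_nil F g a : is_line_integral F g a a 0.
Proof.
exists [::], (fun=> setT); split; first by split => //=.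
  by [].
by rewrite big_ord0.
Qed.

Lemma is_line_integral_cons F g a c b U v : a < c -> form_cover F U ->
  g @` `[a, c] `<=` U -> is_line_integral F g c b v ->
  is_line_integral F g a b (pot F U (g c) - pot F U (g a) + v).
Proof.
move=> ac FU gU [s [V [[ps /eqP ls] hV ->]]].
exists (c :: s), (fun i => if i is j.+1 then V j else U); split.
- by split; [rewrite /= ac | rewrite /= ls].
- by move=> [_|i /hV].
- by rewrite big_ord_recl.
Qed.

Lemma is_line_integral_inv F g a b v : is_line_integral F g a b v ->
  (a = b /\ v = 0) \/ exists c U w, [/\ a < c <= b, form_cover F U,
    g @` `[a, c] `<=` U, is_line_integral F g c b w &
    v = pot F U (g c) - pot F U (g a) + w].
Proof.
move=> [[|c s] [V [ps hV ->]]].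
  by left; rewrite big_ord0; split=> //; exact: itv_partition_nil ps.
right; have [FU gU] := hV 0%N isT.
have ps' := itv_partition_cons ps.
exists c, (V 0%N), (\sum_(i < size s)
  (pot F (V i.+1) (g (nth b (c :: s) i.+1)) -
   pot F (V i.+1) (g (nth b (c :: s) i)))); split=> //.
- rewrite (itv_partition_le ps') andbT.
  by case: ps => /= /andP[].
- exists s, (fun i => V i.+1); split=> //.
  by move=> i si; exact: (hV i.+1).
- by rewrite big_ord_recl.
Qed.

Lemma is_line_integral_le F g a b v : is_line_integral F g a b v -> a <= b.
Proof. by move=> [s [V [/itv_partition_le]]]. Qed.

Lemma is_line_integral_ind F g b (P : K -> K -> Prop) :
  P b 0 ->
  (forall a c U v, a < c <= b -> form_cover F U -> g @` `[a, c] `<=` U ->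
    is_line_integral F g c b v -> P c v ->
    P a (pot F U (g c) - pot F U (g a) + v)) ->
  forall a v, is_line_integral F g a b v -> P a v.
Proof.
move=> P0 PS a v [s]; elim: s a v => [|c s IH] a v [V [ps hV ->]].
  by rewrite big_ord0 (itv_partition_nil ps).
have [FU gU] := hV 0%N isT; have ps' := itv_partition_cons ps.
have ac : a < c <= b.
  by rewrite (itv_partition_le ps') andbT; case: ps => /= /andP[].
have h : exists V' : nat -> set T, [/\ itv_partition c b s,
    forall i, (i < size s)%N -> form_cover F (V' i) /\
      g @` `[nth b (c :: s) i, nth b (c :: s) i.+1] `<=` V' i
    & \sum_(i < size s) (pot F (V i.+1) (g (nth b (c :: s) i.+1)) -
                         pot F (V i.+1) (g (nth b (c :: s) i))) =
      \sum_(i < size s) (pot F (V' i) (g (nth b (c :: s) i.+1)) -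
                         pot F (V' i) (g (nth b (c :: s) i)))].
  by exists (fun i => V i.+1); split=> // i si; exact: (hV i.+1).
rewrite big_ord_recl /=; apply: PS => //; first by exists s.
by apply: IH.
Qed.

Lemma near_path g a b t (U : set T) : {within `[a, b], continuous g} ->
  t \in `[a, b] -> open U -> U (g t) ->
  \forall t' \near t, t' \in `[a, b] -> U (g t').
Proof.
move=> /subspace_continuousP cg tab oU Ugt.
by have := cg t tab U (open_nbhs_nbhs (conj oU Ugt)); rewrite /= near_simpl /within /=.
Qed.

Lemma near_path_constant g a b t (B : set T) (f : T -> K) :
  {within `[a, b], continuous g} -> t \in `[a, b] -> B (g t) ->
  locally_constant B f ->
  \forall t' \near t, t' \in `[a, b] -> B (g t') -> f (g t') = f (g t).
Proof.
move=> /subspace_continuousP cg tab Bgt lf.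
have := lf _ Bgt; rewrite near_withinE => h.
by have := cg t tab _ h; rewrite /= near_simpl /within /=.
Qed.

Lemma line_integral_primitive F g a b v : {within `[a, b], continuous g} ->
  is_line_integral F g a b v ->
  exists h : K -> K, h b - h a = v /\
    forall U (t : K), form_cover F U -> t \in `[a, b] -> U (g t) ->
      \forall t' \near t, t' \in `[a, b] -> U (g t') ->
        h t' - pot F U (g t') = h t - pot F U (g t).
Proof.
move=> cg hv; move: a v hv cg; apply: is_line_integral_ind.
  move=> _; exists (fun=> 0); split; first by rewrite subrr.
  move=> U t FU; rewrite itvxx inE => /eqP -> _.
  by near=> t'; rewrite itvxx inE => /eqP ->.
move=> a c U v /andP[ac cb] FU gU _ IH cg.
have cg' : {within `[c, b], continuous g}.
  apply: continuous_subspaceW cg; apply: subset_itvr.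
  by rewrite bnd_simp ltW.
have [h [hv hh]] := IH cg'.
pose k t := if t <= c then pot F U (g t) - pot F U (g c) + h c else h t.
have kc : k c = h c by rewrite /k lexx subrr add0r.
have kge t : c <= t -> k t = h t.
  rewrite le_eqVlt => /predU1P[<-//|ct]; by rewrite /k leNgt ct.
exists k; split.
  by rewrite kge// /k (ltW ac) -hv; ring.
move=> V t FV tab Vgt.
have nU t' : a <= t' -> t' <= c -> U (g t').
  by move=> h1 h2; apply: gU; exists t' => //=; rewrite in_itv /= h1.
have L : t <= c -> \forall t' \near t, t' \in `[a, b] -> V (g t') -> t' <= c ->
    k t' - pot F V (g t') = k t - pot F V (g t).
  move=> tc; have at_ : a <= t by move: tab; rewrite in_itv => /andP[].
  have Bt : ([set: T] `&` U `&` V) (g t) by split=> //; split=> //; exact: nU.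
  have := near_path_constant cg tab Bt (pot_compat FU FV).
  apply: filterS => t' + t'ab Vt' t'c; rewrite /k t'c tc => /(_ t'ab).
  have at' : a <= t' by move: t'ab; rewrite in_itv => /andP[].
  move=> /(_ _)/wrap[]; first by split=> //; split=> //; exact: nU.
  by move=> e; lra.
have Rr : c <= t -> \forall t' \near t, t' \in `[a, b] -> V (g t') -> c <= t' ->
    k t' - pot F V (g t') = k t - pot F V (g t).
  move=> ct; have tb : t <= b by move: tab; rewrite in_itv => /andP[].
  have tcb : t \in `[c, b] by rewrite in_itv /= ct.
  have := hh V t FV tcb Vgt; apply: filterS => t' + t'ab Vt' ct'.
  have t'b : t' <= b by move: t'ab; rewrite in_itv => /andP[].
  rewrite !kge//; apply => //.
  by rewrite in_itv /= ct'.
have [tc|ct|tc] := ltgtP t c.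
- have n1 : \forall t' \near t, t' < c by exact: lt_nbhsl.
  have := L (ltW tc); apply: filterS2 n1 => t' t'c + h1 h2.
  by move=> /(_ h1 h2 (ltW t'c)).
- have n1 : \forall t' \near t, c < t' by exact: lt_nbhsr.
  have := Rr (ltW ct); apply: filterS2 n1 => t' t'c + h1 h2.
  by move=> /(_ h1 h2 (ltW t'c)).
- have h1 : t <= c by rewrite tc.
  have h2 : c <= t by rewrite tc.
  have := Rr h2; have := L h1.
  apply: filterS2 => t' l r h3 h4.
  by have [?|/ltW ?] := leP t' c; [exact: l|exact: r].
Unshelve. all: by end_near. Qed.

Lemma is_line_integral_unique F G g a b v w :
  {within `[a, b], continuous g} -> form_equiv F G ->
  is_line_integral F g a b v -> is_line_integral G g a b w -> v = w.
Proof.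
move=> cg FG hv hw; have ab := is_line_integral_le hv.
have [h [<- hh]] := line_integral_primitive cg hv.
have [k [<- kk]] := line_integral_primitive cg hw.
have lc : locally_constant `[a, b] (fun t => h t - k t).
  move=> t tab; change (Real.sort K) in t.
  have [oF cF] := form_coverP F; have [U FU Ut] := cF (g t) I.
  have [oG cG] := form_coverP G; have [V GV Vt] := cG (g t) I.
  have Bt : ([set: T] `&` U `&` V) (g t) by [].
  have nc := near_path_constant cg tab Bt (FG _ _ FU GV).
  have nU := near_path cg tab (oF _ FU) Ut.
  have nV := near_path cg tab (oG _ GV) Vt.
  have nh := hh U t FU tab Ut; have nk := kk V t GV tab Vt.
  rewrite near_withinE.
  suff : \forall t' \near t, t' \in `[a, b] -> h t' - k t' = h t - k t by [].
  have ft : @Filter K (nbhs (t : K)) := nbhs_filter (t : K).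
  have nUV := @filterI K _ ft _ _ nU nV.
  have nhk := @filterI K _ ft _ _ nh nk.
  apply: (@filterS3 K _ ft _ _ _ _ _ nUV nhk nc) => t' [hU hV] [h1 h2] h3 t'ab.
  have U' := hU t'ab; have V' := hV t'ab.
  have e1 := h1 t'ab U'; have e2 := h2 t'ab V'.
  have B' : ([set: T] `&` U `&` V) (g t') by [].
  have e3 := h3 t'ab B'.
  by lra.
have aI : `[a, b]%classic a by rewrite /= in_itv /= lexx.
have bI : `[a, b]%classic b by rewrite /= in_itv /= lexx andbT.
have := locally_constant_connected (@segment_connected K a b) lc aI bI.
by lra.
Qed.

Lemma line_integral_exists F g a b : a <= b ->
  {within `[a, b], continuous g} -> exists v, is_line_integral F g a b v.
Proof.
move=> ab cg.
pose S := [set t | a <= t <= b /\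
  forall t', t <= t' <= b -> exists v, is_line_integral F g t' b v].
have Sb : S b.
  split; first by rewrite ab lexx.
  move=> t' bt'; have <- : b = t' by exact: le_anti.
  exists 0; exact: is_line_integral_nil.
have lbS : lbound S a by move=> t [/andP[]].
have hiS : has_inf S by split; [exists b|exists a].
pose c := inf S.
have ac : a <= c by apply: lb_le_inf; [exists b|].
have cb : c <= b by apply: ge_inf => //; exists a.
have cab : c \in `[a, b] by rewrite in_itv /= ac.
have [oF cF] := form_coverP F; have [U FU Uc] := cF (g c) I.
have [e /= e0 eU] := (nbhs_ballP _ _).1 (near_path cg cab (oF _ FU) Uc).
have [t [/andP[at_ tb] tS] tce] := inf_adherent e0 hiS.
rewrite -/c in tce.
have ct : c <= t by apply: ge_inf; [exists a|split=> //; rewrite at_].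
have key t' : a <= t' <= b -> c - e < t' ->
    exists v, is_line_integral F g t' b v.
  move=> /andP[at' t'b] ct'.
  have [tt'|t't] := leP t t'; first by apply: tS; rewrite tt'.
  have [v hv] := tS t (introT andP (conj (lexx t) tb)).
  exists (pot F U (g t) - pot F U (g t') + v).
  apply: is_line_integral_cons => // z [r /=]; rewrite in_itv /= => /andP[r1 r2] <-.
  apply: eU; last first.
    by rewrite in_itv /= (le_trans at' r1) (le_trans r2 tb).
  rewrite /ball /= ltr_norml; apply/andP; split; lra.
have [cEa|cna] := eqVneq c a.
  by apply: key; [rewrite lexx|rewrite cEa; lra].
have ac' : a < c by rewrite lt_neqAle eq_sym cna.
pose d := Num.max a (c - e / 2).
have dc : d < c by rewrite gt_max ac'/=; lra.
have ad : a <= d by rewrite le_max lexx.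
have Sd : S d.
  split; first by rewrite ad (le_trans (ltW dc)).
  move=> t' /andP[dt' t'b]; apply: key.
    by rewrite (le_trans ad dt').
  have : c - e / 2 <= d by rewrite le_max lexx orbT.
  by lra.
have : c <= d by apply: ge_inf => //; exists a.
by rewrite leNgt dc.
Qed.

Lemma line_integralE F g a b v : {within `[a, b], continuous g} ->
  is_line_integral F g a b v ->
  line_integral (\pi_(closed_form K [set: T]) F) g a b = v.
Proof.
move=> cg hv; have ab := is_line_integral_le hv.
have [w hw] := line_integral_exists (repr (\pi_(closed_form K [set: T]) F)) ab cg.
have hi : is_line_integral (repr (\pi_(closed_form K [set: T]) F)) g a b
    (line_integral (\pi_(closed_form K [set: T]) F) g a b).
  exact: (@getI K _ w hw).
exact: (is_line_integral_unique cg (@repr_form_equiv K T _ F) hi hv).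
Qed.

End LineIntegral.

Section CechH1.
Context (K : realType) {T : topologicalType}.
Implicit Types A B : set T.

(* One-dimensional Cech cocycles on the subspace A with coefficients in the
   sheaf of locally constant K-valued functions. Covers are indexed by their
   own members; such covers are cofinal among all open covers. *)
Record cech_cocycle A := CechCocycle {
  cech_cover : set (set T) ;
  coef : set T -> set T -> T -> K ;
  cech_coverP : is_open_cover A cech_cover ;
  coef_locally_constant : forall U V, cech_cover U -> cech_cover V ->
    locally_constant (A `&` U `&` V) (coef U V) ;
  coef_cocycle : forall U V W x,
    cech_cover U -> cech_cover V -> cech_cover W ->
    A x -> U x -> V x -> W x -> coef U V x + coef V W x = coef U W x }.

HB.instance Definition _ A := gen_eqMixin (cech_cocycle A).
HB.instance Definition _ A := gen_choiceMixin (cech_cocycle A).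

(* Equality in the direct limit over the open covers: on some common refinement
   C, with refinement maps r and r', the two cocycles differ by the coboundary
   of the 0-cochain h. *)
Definition cohomologous A (c c' : cech_cocycle A) :=
  exists (C : set (set T)) (r r' : set T -> set T) (h : set T -> T -> K),
    [/\ is_open_cover A C,
        forall W, C W -> cech_cover c (r W) /\ A `&` W `<=` r W,
        forall W, C W -> cech_cover c' (r' W) /\ A `&` W `<=` r' W,
        forall W, C W -> locally_constant (A `&` W) (h W)
      & forall W W' x, C W -> C W' -> A x -> W x -> W' x ->
          coef c (r W) (r W') x - coef c' (r' W) (r' W') x = h W' x - h W x].

Lemma cohomologous_refl A (c : cech_cocycle A) : cohomologous c c.
Proof.
exists (cech_cover c), id, id, (fun _ _ => 0); split.
- exact: cech_coverP.
- by move=> W cW; split=> // x [].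
- by move=> W cW; split=> // x [].
- by move=> W _; exact: locally_constant_cst.
- by move=> *; ring.
Qed.

Lemma cohomologous_sym A (c c' : cech_cocycle A) :
  cohomologous c c' -> cohomologous c' c.
Proof.
move=> [C [r [r' [h [oC rC r'C lh eh]]]]].
exists C, r', r, (fun W x => 0 - h W x); split=> //.
  by move=> W CW; apply: locally_constantB (lh _ CW); exact: locally_constant_cst.
by move=> W W' x CW CW' Ax Wx Wx'; have := eh _ _ _ CW CW' Ax Wx Wx'; lra.
Qed.

Lemma cohomologous_trans A (c1 c2 c3 : cech_cocycle A) :
  cohomologous c1 c2 -> cohomologous c2 c3 -> cohomologous c1 c3.
Proof.
move=> [C [r [r' [h [[oC cC] rC r'C lh eh]]]]].
move=> [D [q [q' [k [[oD cD] qD q'D lk ek]]]]].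
pose E : set (set T) := [set Z | exists WV : set T * set T,
  [/\ C WV.1, D WV.2 & Z = WV.1 `&` WV.2]].
have /choice [p pE] : forall Z, exists WV : set T * set T, E Z ->
    [/\ C WV.1, D WV.2 & Z = WV.1 `&` WV.2].
  move=> Z; have [[WV h1]|n] := pselect (E Z); first by exists WV.
  by exists (setT, setT).
have c2loc Z : E Z -> locally_constant (A `&` Z)
    (coef c2 (q (p Z).2) (r' (p Z).1)).
  move=> /pE [Cp Dp eZ].
  have [qc qs] := qD _ Dp; have [rc rs] := r'C _ Cp.
  apply: locally_constant_sub (coef_locally_constant qc rc).
  rewrite {1}eZ => x [Ax [x1 x2]]; split; last exact: rs.
  by split=> //; exact: qs.
exists E, (fun Z => r (p Z).1), (fun Z => q' (p Z).2),
  (fun Z x => h (p Z).1 x - (0 - k (p Z).2 x) -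
     (0 - coef c2 (q (p Z).2) (r' (p Z).1) x)); split.
- split.
    by move=> Z [[W V] [/= CW DV ->]]; apply: openI; [exact: oC|exact: oD].
  move=> x Ax; have [W CW Wx] := cC x Ax; have [V DV Vx] := cD x Ax.
  by exists (W `&` V) => //; exists (W, V).
- move=> Z /pE [Cp Dp eZ]; have [? h1] := rC _ Cp; split=> // x [Ax].
  by rewrite {1}eZ => -[x1 _]; exact: h1.
- move=> Z /pE [Cp Dp eZ]; have [? h1] := q'D _ Dp; split=> // x [Ax].
  by rewrite {1}eZ => -[_ x2]; exact: h1.
- move=> Z EZ; have [Cp Dp eZ] := pE _ EZ.
  apply: locally_constantB; last first.
    by apply: locally_constantB (c2loc _ EZ); exact: locally_constant_cst.
  apply: locally_constantB.
    apply: locally_constant_sub (lh _ Cp).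
    by rewrite {1}eZ => x [Ax [x1 x2]].
  apply: locally_constantB; first exact: locally_constant_cst.
  apply: locally_constant_sub (lk _ Dp).
  by rewrite {1}eZ => x [Ax [x1 x2]].
- move=> Z Z' x EZ EZ' Ax Zx Z'x.
  have [Cp Dp eZ] := pE _ EZ; have [Cp' Dp' eZ'] := pE _ EZ'.
  move: Zx Z'x; rewrite {1}eZ {1}eZ' => -[x1 x2] [x1' x2'].
  have e1 := eh _ _ _ Cp Cp' Ax x1 x1'.
  have e2 := ek _ _ _ Dp Dp' Ax x2 x2'.
  have [r'c r's] := r'C _ Cp; have [r'c' r's'] := r'C _ Cp'.
  have [qc qs] := qD _ Dp; have [qc' qs'] := qD _ Dp'.
  have a1 : r' (p Z).1 x by exact: r's.
  have a1' : r' (p Z').1 x by exact: r's'.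
  have a2 : q (p Z).2 x by exact: qs.
  have a2' : q (p Z').2 x by exact: qs'.
  have f1 := coef_cocycle qc r'c r'c' Ax a2 a1 a1'.
  have f2 := coef_cocycle qc qc' r'c' Ax a2 a2' a1'.
  lra.
Qed.

Definition cohomologousb A (c c' : cech_cocycle A) := `[< cohomologous c c' >].

Lemma cohomologousb_refl A : reflexive (@cohomologousb A).
Proof. by move=> c; exact/asboolP/cohomologous_refl. Qed.

Lemma cohomologousb_sym A : symmetric (@cohomologousb A).
Proof. by move=> c c'; apply/idP/idP => /asboolP/cohomologous_sym/asboolP. Qed.

Lemma cohomologousb_trans A : transitive (@cohomologousb A).
Proof.
move=> c2 c1 c3 /asboolP h /asboolP h'.
exact/asboolP/(cohomologous_trans h h').
Qed.

Canonical cohomologous_rel A := EquivRel (@cohomologousb A)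
  (@cohomologousb_refl A) (@cohomologousb_sym A) (@cohomologousb_trans A).

Definition cech_H1 A := {eq_quot (cohomologous_rel A)}.

Lemma cech_H1_eqP A (c c' : cech_cocycle A) :
  \pi_(cech_H1 A) c = \pi_(cech_H1 A) c' <-> cohomologous c c'.
Proof.
split=> [|h]; first by move=> /eqmodP/asboolP.
by apply/eqmodP; exact/asboolP.
Qed.

Lemma repr_cohomologous A (c : cech_cocycle A) :
  cohomologous (repr (\pi_(cech_H1 A) c)) c.
Proof. by apply/cech_H1_eqP; rewrite reprK. Qed.

Section Zero.
Variable A : set T.

Lemma zero_locally_constant U V : [set setT] U -> [set setT] V ->
  locally_constant (A `&` U `&` V) ((fun _ _ _ => 0 : K) U V).
Proof. by move=> _ _; exact: locally_constant_cst. Qed.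

Lemma zero_cocycle U V W x : [set setT] U -> [set setT] V -> [set setT] W ->
  A x -> U x -> V x -> W x ->
  (fun _ _ _ => 0 : K) U V x + (fun _ _ _ => 0) V W x = (fun _ _ _ => 0) U W x.
Proof. by move=> *; rewrite addr0. Qed.

Definition cech_zero : cech_H1 A := \pi_(cech_H1 A)
  (CechCocycle (is_open_coverT A) zero_locally_constant zero_cocycle).

End Zero.

Section Restriction.
Variables (A B : set T) (BA : B `<=` A).

Lemma cocycle_restr_locally_constant (c : cech_cocycle A) U V :
  cech_cover c U -> cech_cover c V ->
  locally_constant (B `&` U `&` V) (coef c U V).
Proof.
move=> cU cV; apply: locally_constant_sub (coef_locally_constant cU cV).
by move=> x [[/BA]].
Qed.

Lemma cocycle_restr_cocycle (c : cech_cocycle A) U V W x :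
  cech_cover c U -> cech_cover c V -> cech_cover c W ->
  B x -> U x -> V x -> W x -> coef c U V x + coef c V W x = coef c U W x.
Proof. by move=> cU cV cW /BA; exact: coef_cocycle. Qed.

Definition cocycle_restr (c : cech_cocycle A) : cech_cocycle B :=
  CechCocycle (is_open_cover_sub BA (cech_coverP c))
    (@cocycle_restr_locally_constant c) (@cocycle_restr_cocycle c).

Definition cech_restr (xi : cech_H1 A) : cech_H1 B :=
  \pi_(cech_H1 B) (cocycle_restr (repr xi)).

Lemma cech_restr_pi (c : cech_cocycle A) :
  cech_restr (\pi_(cech_H1 A) c) = \pi_(cech_H1 B) (cocycle_restr c).
Proof.
apply/cech_H1_eqP.
have [C [r [r' [h [oC rC r'C lh eh]]]]] := repr_cohomologous c.
exists C, r, r', h; split.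
- exact: is_open_cover_sub oC.
- by move=> W /rC [? s]; split=> // x [/BA Ax Wx]; exact: s.
- by move=> W /r'C [? s]; split=> // x [/BA Ax Wx]; exact: s.
- by move=> W /lh; apply: locally_constant_sub => x [/BA].
- by move=> W W' x CW CW' /BA; exact: eh.
Qed.

End Restriction.

Section Connecting.
Variable A : set T.

Lemma connecting_cocycle (F : form_family K A) U V W x :
  form_cover F U -> form_cover F V -> form_cover F W ->
  A x -> U x -> V x -> W x ->
  (pot F V x - pot F U x) + (pot F W x - pot F V x) = pot F W x - pot F U x.
Proof. by move=> *; ring. Qed.

Lemma connecting_locally_constant (F : form_family K A) U V :
  form_cover F U -> form_cover F V ->
  locally_constant (A `&` U `&` V) (fun x => pot F V x - pot F U x).
Proof. by move=> FU FV; rewrite setIAC; exact: pot_compat. Qed.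

Definition family_cocycle (F : form_family K A) : cech_cocycle A :=
  CechCocycle (form_coverP F) (@connecting_locally_constant F)
    (@connecting_cocycle F).

(* The connecting homomorphism H^0(A; C_A / K_A) -> H^1(A; K_A): the potentials
   of a form are local lifts to C_A of a section of C_A / K_A, and their
   differences form the cocycle. *)
Definition connecting (w : closed_form K A) : cech_H1 A :=
  \pi_(cech_H1 A) (family_cocycle (repr w)).

Lemma connecting_pi (F : form_family K A) :
  connecting (\pi_(closed_form K A) F) = \pi_(cech_H1 A) (family_cocycle F).
Proof.
apply/cech_H1_eqP; have := @repr_form_equiv K T A F.
move: (repr _) => G GF.
pose E : set (set T) := [set Z | exists WV : set T * set T,
  [/\ form_cover G WV.1, form_cover F WV.2 & Z = WV.1 `&` WV.2]].
have /choice [p pE] : forall Z, exists WV : set T * set T, E Z ->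
    [/\ form_cover G WV.1, form_cover F WV.2 & Z = WV.1 `&` WV.2].
  move=> Z; have [[WV h1]|n] := pselect (E Z); first by exists WV.
  by exists (setT, setT).
have [oG cG] := form_coverP G; have [oF cF] := form_coverP F.
exists E, (fun Z => (p Z).1), (fun Z => (p Z).2),
  (fun Z x => pot G (p Z).1 x - pot F (p Z).2 x); split.
- split.
    by move=> Z [[W V] [/= CW DV ->]]; apply: openI; [exact: oG|exact: oF].
  move=> x Ax; have [W CW Wx] := cG x Ax; have [V DV Vx] := cF x Ax.
  by exists (W `&` V) => //; exists (W, V).
- by move=> Z /pE [Cp Dp eZ]; split=> // x [_]; rewrite {1}eZ => -[].
- by move=> Z /pE [Cp Dp eZ]; split=> // x [_]; rewrite {1}eZ => -[].
- move=> Z /pE [Cp Dp eZ]; apply: locally_constant_sub (GF _ _ Cp Dp).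
  by rewrite {1}eZ setIA.
- by move=> *; rewrite /=; ring.
Qed.

End Connecting.

End CechH1.

Section FlowsAndLyapunovForms.
Context {K : realType} {X : metricType K}.
Implicit Types (Phi : X * K -> X) (Y : set X).

Definition is_flow Phi :=
  [/\ continuous Phi, forall x, Phi (x, 0) = x
    & forall x s t, Phi (x, s + t) = Phi (Phi (x, s), t)].

(* Without 0 < N the one-point sequence would make every point chain
   recurrent. *)
Definition has_chain Phi (delta tau : K) (x y : X) :=
  exists (N : nat) (z : nat -> X) (t : nat -> K),
    [/\ (0 < N)%N, z 0%N = x, z N = y
      & forall i, (1 <= i <= N)%N ->
          tau <= t i /\ mdist (Phi (z i.-1, t i)) (z i) < delta].

Definition chain_recurrent_set Phi : set X :=
  [set x | forall delta tau, 0 < delta -> 1 <= tau ->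
             has_chain Phi delta tau x x].

Definition lyapunov_form Phi Y (w : closed_form K [set: X]) :=
  (forall x t, ~ Y x -> 0 < t ->
     line_integral w (fun tau => Phi (x, tau)) 0 t < 0) /\
  (exists (U : set X) (f : X -> K) (fU : {within U, continuous f}),
     [/\ open U, Y `<=` U,
         form_restr (@subsetT _ U) w = exact_form fU
       & forall x y, connected_component Y x y -> f x = f y]).

End FlowsAndLyapunovForms.

Definition path_connected (K : realType) (T : topologicalType) (B : set T) :=
  forall x y, B x -> B y -> exists g : K -> T,
    [/\ {within `[0, 1], continuous g}, g 0 = x, g 1 = y
      & g @` `[0, 1] `<=` B].

Definition locally_path_connected (K : realType) (T : topologicalType) :=
  forall (x : T) (N : set T), nbhs x N ->
    exists V : set T, [/\ open V, V x, V `<=` N & path_connected K V].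

Lemma path_connected_connected (K : realType) (T : topologicalType)
  (B : set T) : path_connected K B -> connected B.
Proof.
move=> pB; have [[x Bx]|B0] := pselect (B !=set0); last first.
  rewrite (_ : B = set0); first exact: connected0.
  by apply/eqP; apply: contrapT => /negP/set0P.
suff -> : B = connected_component B x by exact: component_connected.
apply/seteqP; split; last exact: connected_component_sub.
move=> y By; have [g [cg g0 g1 gB]] := pB x y Bx By.
exists (g @` `[0, 1]); last by exists 1 => //=; rewrite in_itv /= ler01 lexx.
split=> //; first by exists 0 => //=; rewrite in_itv /= ler01 lexx.
apply: connected_continuous_connected => //; exact: segment_connected.
Qed.

Lemma locally_constantP (K : realType) (T : topologicalType) (B : set T)
    (f : T -> K) : locally_path_connected K T -> open B ->
  locally_constant B f <->
  (forall x y, connected_component B x y -> f y = f x).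
Proof.
move=> lpc oB; split=> [lf x y [C [Cx CB cC] Cy]|cf x Bx].
  exact: (locally_constant_connected cC (locally_constant_sub CB lf)).
have [V [oV Vx VB pV]] := lpc x B (open_nbhs_nbhs (conj oB Bx)).
rewrite near_withinE; have := open_nbhs_nbhs (conj oV Vx).
apply: filterS => y Vy By; apply: cf; exists V => //.
by split=> //; exact: path_connected_connected pV.
Qed.

(* Main.v *)
(* Write R for the chain recurrent set. If x is not chain recurrent, the set V of
   points reachable from x by chains of some fixed precision absorbs its own
   flow with a margin, and the truncated distance to the complement of V is a
   function which does not decrease under a fixed iterate of the time-h map,
   increases at x, and takes only the values 0 and 1 on R. Averaging it over
   iterates and summing over countably many such functions gives a continuous L
   with L z <= L (z.h), strictly off R, and constant on the connected subsets
   of R.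

   Since the class vanishes on R, it is represented by local potentials phi_p
   on open sets W_p which are locally constant near R. For small h
   each segment x.[0, h] lies in some W_p, and by compactness some l satisfies
   phi_p (x.h) - phi_p x < l (L (x.h) - L x) off R. The average of phi_p - l L
   over x.[0, h] defines a form in the same class, and it decreases strictly
   along orbits off R since the derivative of a moving average is the difference
   of the end point values, divided by h. *)

Require Import Defs.
From HB Require Import structures.
From mathcomp Require Import all_boot all_order all_algebra generic_quotient.
From mathcomp Require Import all_classical all_reals all_analysis.
From mathcomp Require Import ring lra zify.

Set Implicit Arguments.
Unset Strict Implicit.
Unset Printing Implicit Defensive.

Import Order.TTheory GRing.Theory Num.Theory.
Import numFieldNormedType.Exports.

Local Open Scope classical_set_scope.
Local Open Scope ring_scope.

(** * Metric spaces and flows *)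

(** If [P A] failed, the sets whose complement in [A] satisfies [P] would form a proper filter
    containing [A]. A neighborhood [V] with [P V] around a cluster point of it in [A] has its
    complement in the filter, a contradiction. *)
Lemma compact_set_ind (T : topologicalType) (P : set T -> Prop) (A : set T) :
  compact A -> P set0 -> (forall B C, B `<=` C -> P C -> P B) ->
  (forall B C, P B -> P C -> P (B `|` C)) ->
  (forall x, A x -> exists2 V, nbhs x V & P V) -> P A.
Proof.
move=> cA P0 Psub PU Ploc; apply: contrapT => nPA.
pose F : set_system T := [set B | P (A `\` B)].
have FF : ProperFilter F.
  apply: Build_ProperFilter_ex.
    move=> B FB; apply: contrapT => nB; apply: nPA; apply: Psub FB => x Ax.
    by split=> // Bx; apply: nB; exists x.
  split; first by rewrite /F /= setDT.
    by move=> B C FB FC; rewrite /F /= setDIr; exact: PU.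
  by move=> B C BC; apply: Psub; exact: setDS.
have FA : F A by rewrite /F /= setDv.
have [x [Ax clx]] := cA F FF FA.
have [V nV PV] := Ploc x Ax.
have [y []//] : (~` V) `&` V !=set0.
by apply: clx nV; apply: Psub PV => z [_ /contrapT].
Qed.

Lemma near_comp (S T : topologicalType) (f : S -> T) x (P : set T) :
  {for x, continuous f} -> nbhs (f x) P -> \forall y \near x, P (f y).
Proof. by move=> cf; exact: cf. Qed.

Section MetricLemmas.
Context {K : realType} {X : metricType K}.
Implicit Types (x y z : X) (f : X -> K).

Lemma nbhs_mdistP x (P : set X) :
  nbhs x P <-> exists2 e : K, 0 < e & forall y, mdist x y < e -> P y.
Proof.
split=> [/nbhs_ballP[e /= e0 h]|[e e0 h]].
  by exists e => // y xy; apply: h; rewrite ballEmdist.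
by apply/nbhs_ballP; exists e => //= y; rewrite ballEmdist; exact: h.
Qed.

Lemma near_mdist_lt x y (e : K) : mdist x y < e -> \forall z \near y, mdist x z < e.
Proof.
move=> xye; apply/nbhs_mdistP; exists (e - mdist x y); first by rewrite subr_gt0.
by move=> z yz; have := metric_triangle x y z; lra.
Qed.

Lemma near_mdist x (e : K) : 0 < e -> \forall y \near x, mdist x y < e.
Proof. by move=> e0; apply: near_mdist_lt; rewrite mdistxx. Qed.

Lemma near_mdist_gt x y (e : K) : e < mdist x y -> \forall z \near y, e < mdist x z.
Proof.
move=> exy; apply/nbhs_mdistP; exists (mdist x y - e); first by rewrite subr_gt0.
by move=> z yz; have := metric_triangle x z y; rewrite (metric_sym z y); lra.
Qed.

Lemma lipschitz_continuous f (k : K) :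
  (forall x y, f y - f x <= k * mdist x y) -> continuous f.
Proof.
move=> lf x; apply/cvgrPdist_lt => e e0; apply/nbhs_mdistP.
(* [k] may be zero or negative, so the radius is built from a positive majorant. *)
have k1 : 0 < `|k| + 1 by rewrite ltr_pwDr.
exists (e / (`|k| + 1)); first by rewrite divr_gt0.
move=> y; rewrite ltr_pdivlMr// mulrC => h.
have := lf x y; have := lf y x; rewrite (metric_sym y x).
have : k * mdist x y <= (`|k| + 1) * mdist x y.
  by apply: ler_wpM2r; [exact: mdist_ge0|have := ler_norm k; lra].
by rewrite ltr_norml; lra.
Qed.

Lemma compact_uniform_continuous (f : X -> X) (e : K) :
  compact [set: X] -> continuous f -> 0 < e ->
  exists2 d : K, 0 < d & forall x y, mdist x y < d -> mdist (f x) (f y) < e.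
Proof.
move=> cX cf e0.
(* Only the first of the two points is confined to [A], so that [P] passes to unions. *)
pose P A := exists2 d : K, 0 < d &
  forall x y, A x -> mdist x y < d -> mdist (f x) (f y) < e.
suff [d d0 h] : P setT by exists d => // x y; exact: h.
apply: (compact_set_ind cX).
- by exists 1.
- by move=> B C BC [d d0 h]; exists d => // x y /BC; exact: h.
- move=> B C [d d0 h] [d' d'0 h']; exists (Num.min d d'); first by rewrite lt_min d0.
  by move=> x y BCx; rewrite lt_min => /andP[? ?]; case: BCx => [/h|/h']; exact.
move=> x _.
have /nbhs_mdistP[d d0 h] : \forall y \near x, mdist (f x) (f y) < e / 2.
  have e2 : 0 < e / 2 by rewrite divr_gt0.
  exact: near_comp (cf x) (near_mdist (f x) e2).
exists [set y | mdist x y < d / 2].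
  by apply: near_mdist; rewrite divr_gt0.
exists (d / 2); first by lra.
move=> y z /= xy yz; have := metric_triangle x y z.
have hy : mdist (f x) (f y) < e / 2 by apply: h; lra.
move=> xz; have hz : mdist (f x) (f z) < e / 2 by apply: h; lra.
by have := metric_triangle (f y) (f x) (f z); rewrite (metric_sym (f y) (f x)); lra.
Qed.

End MetricLemmas.

(** * Orbits and chains of a continuous flow *)

Section Flow.
Context {K : realType} {X : metricType K} (Phi : X * K -> X).
Hypothesis flowPhi : is_flow Phi.

Lemma flow_continuous : continuous Phi. Proof. by case: flowPhi. Qed.

Lemma flow0 x : Phi (x, 0) = x. Proof. by case: flowPhi. Qed.

Lemma flowD x s t : Phi (Phi (x, s), t) = Phi (x, s + t).
Proof. by case: flowPhi. Qed.

Lemma flow_continuousl t : continuous (fun x => Phi (x, t)).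
Proof.
move=> x W /(@flow_continuous (x, t)) [[A B] /= [nA nB] AB].
by apply: filterS nA => y Ay; apply: (AB (y, t)); split=> //; exact: nbhs_singleton.
Qed.

Lemma flow_continuousr x : continuous (fun t => Phi (x, t)).
Proof.
move=> t W /(@flow_continuous (x, t)) [[A B] /= [nA nB] AB].
by apply: filterS nB => y By; apply: (AB (x, y)); split=> //; exact: nbhs_singleton.
Qed.

Lemma orbit_connected x (a b : K) : connected ((fun t => Phi (x, t)) @` `[a, b]).
Proof.
apply: connected_continuous_connected; first exact: segment_connected.
exact: continuous_subspaceT (@flow_continuousr x).
Qed.

(** A tube lemma: joint continuity of [Phi] and compactness of the time interval. *)
Lemma near_orbit_sub (W : set X) x (a b : K) : open W ->
  (forall t, a <= t <= b -> W (Phi (x, t))) ->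
  \forall y \near x, forall t, a <= t <= b -> W (Phi (y, t)).
Proof.
move=> oW h.
pose P y t := W (Phi (y, t)).
have cov := (compact_near_coveringP _).1 (@segment_compact K a b) X (nbhs x) P _.
suff /cov : forall t : K, `[a, b]%classic t ->
    \forall t' \near t & y \near x, P y t'.
  by apply: filterS => y hy s sab; apply: hy; rewrite /= in_itv.
move=> t /=; rewrite in_itv /= => tab.
have /= := @flow_continuous (x, t) W (open_nbhs_nbhs (conj oW (h t tab))).
move=> [[A B] /= [nA nB] AB]; exists (B, A) => //= -[s y] /= [Bs Ay].
exact: (AB (y, s)).
Qed.

Lemma has_chain_sub (d d' s s' : K) x y : d <= d' -> s' <= s ->
  has_chain Phi d s x y -> has_chain Phi d' s' x y.
Proof.
move=> dd ss [N [z [t [N0 z0 zN h]]]]; exists N, z, t; split=> // i /h[h1 h2].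
by split; [exact: le_trans h1|exact: lt_le_trans h2 _].
Qed.

Lemma has_chain1 (d s : K) x y t : s <= t -> mdist (Phi (x, t)) y < d ->
  has_chain Phi d s x y.
Proof.
move=> st h; exists 1%N, (fun i => if i is 0%N then x else y), (fun=> t).
by split=> // -[|[|]].
Qed.

Lemma has_chain_rcons (d s : K) x y w t : has_chain Phi d s x y -> s <= t ->
  mdist (Phi (y, t)) w < d -> has_chain Phi d s x w.
Proof.
move=> [N [z [u [N0 z0 zN h]]]] st yw.
exists N.+1, (fun i => if (i <= N)%N then z i else w),
  (fun i => if (i <= N)%N then u i else t); split=> //.
  by rewrite ltnn.
move=> [//|i] /andP[_]; rewrite ltnS => iN /=; rewrite iN.
case: ltnP => iN'; first exact: h.
have -> : i = N by apply/eqP; rewrite eqn_leq iN.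
by rewrite zN.
Qed.

(* The last jump is singled out since its precision can be used once more. *)
Lemma has_chain_last (A : set X) (d s : K) x y : A x ->
  (forall a b t, A a -> s <= t -> mdist (Phi (a, t)) b < d -> A b) ->
  has_chain Phi d s x y -> exists a t, [/\ A a, s <= t & mdist (Phi (a, t)) y < d].
Proof.
move=> Ax cA [N [z [t [N0 z0 zN h]]]]; case: N N0 zN h => // N _ zN h.
have Az i : (i <= N)%N -> A (z i).
  elim: i => [|i IH] iN; first by rewrite z0.
  have [h1 h2] := h i.+1 (ltnW iN : (1 <= i.+1 <= N.+1)%N).
  exact: cA (IH (ltnW iN)) h1 h2.
have [h1 h2] := h N.+1 (leqnn _ : (1 <= N.+1 <= N.+1)%N).
by exists (z N), (t N.+1); split; [exact: Az|exact: h1|rewrite -zN].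
Qed.

(** Only the first and the last jump of a closed chain see its base point, and their strict
    inequalities survive a small move of it. *)
Lemma open_has_chain (d s : K) : open [set x | has_chain Phi d s x x].
Proof.
rewrite openE => x /= [N [z [t [N0 z0 zN h]]]].
(* A single jump moves with the base point at both ends, so each end gets half of the slack. *)
have [N1|N1] := eqVneq N 1%N.
  have [h1 h2] := h 1%N (introT andP (conj (leqnn 1) N0)).
  rewrite /= z0 in h2; have {}h2 : mdist (Phi (x, t 1%N)) x < d.
    by rewrite -[X in mdist _ X]zN N1.
  have e0 : 0 < (d - mdist (Phi (x, t 1%N)) x) / 2 by lra.
  have n1 : \forall y \near x, mdist (Phi (x, t 1%N)) (Phi (y, t 1%N)) <
      (d - mdist (Phi (x, t 1%N)) x) / 2.
    exact: (near_comp (@flow_continuousl _ _) (near_mdist _ e0)).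
  have n2 : \forall y \near x, mdist x y < (d - mdist (Phi (x, t 1%N)) x) / 2.
    exact: near_mdist.
  apply: filterS2 n1 n2 => y m1 m2; apply: (has_chain1 h1).
  have := metric_triangle (Phi (y, t 1%N)) (Phi (x, t 1%N)) y.
  have := metric_triangle (Phi (x, t 1%N)) x y.
  by rewrite (metric_sym (Phi (y, t 1%N)) (Phi (x, t 1%N))); lra.
have N2 : (1 < N)%N by rewrite ltn_neqAle eq_sym N1.
have [h1 h1'] := h 1%N (introT andP (conj (leqnn 1) N0)).
have [h2 h2'] := h N (introT andP (conj N0 (leqnn N))).
have n1 : \forall y \near x, mdist (Phi (y, t 1%N)) (z 1%N) < d.
  rewrite /= z0 metric_sym in h1'.
  have := near_comp (@flow_continuousl _ _) (near_mdist_lt h1').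
  by apply: filterS => w; rewrite metric_sym.
have n2 : \forall y \near x, mdist (Phi (z N.-1, t N)) y < d.
  by apply: near_mdist_lt; rewrite -[X in mdist _ X]zN.
apply: filterS2 n1 n2 => y m1 m2.
exists N, (fun i => if (i == 0%N) || (i == N) then y else z i), t; split=> //.
  by rewrite eqxx orbT.
move=> i /andP[i0 iN]; have [hh1 hh2] := h i (introT andP (conj i0 iN)).
split=> //; rewrite [i == 0%N]eqn0Ngt i0 /=.
have -> : (i.-1 == N) = false by apply/eqP; lia.
rewrite orbF; case: eqP => [|/eqP] i1; case: eqP => [|/eqP] i2.
- lia.
- by have -> : i = 1%N by lia.
- by rewrite i2.
- by [].
Qed.

(** The time-[t] map commutes with the flow and is uniformly continuous, so it carries fine chains
    to fine chains with the same times. *)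
Lemma chain_recurrent_flow x t : compact [set: X] ->
  chain_recurrent_set Phi x -> chain_recurrent_set Phi (Phi (x, t)).
Proof.
move=> cX Rx d s d0 s1.
have [e e0 he] := compact_uniform_continuous cX (@flow_continuousl t) d0.
have [N [z [u [N0 z0 zN h]]]] := Rx e s e0 s1.
exists N, (fun i => Phi (z i, t)), u; split; rewrite ?z0 ?zN//.
move=> i /h[h1 h2]; split=> //; rewrite flowD addrC -flowD; exact: he.
Qed.

End Flow.

(** * A Lyapunov function for a discrete time step *)

Section ConleyFunction.
Context {K : realType} {X : metricType K} (Phi : X * K -> X).
Hypotheses (flowPhi : is_flow Phi) (compactX : compact [set: X]).
Let R := chain_recurrent_set Phi.

Section Reachable.
Variables (d s : K) (x : X).
Hypotheses (d0 : 0 < d) (s1 : 1 <= s) (nx : ~ has_chain Phi d s x x).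
Let V y := has_chain Phi d s x y.

(** Distance to the complement of [V] in units of [d], cut off at 1, so that 1 is attained where the
    whole [d]-ball lies in [V]. By [nx] the point [x] is in that complement, so the infimum is over
    a nonempty set. *)
Let depth (z : X) : K := inf [set Num.min 1 (mdist z w / d) | w in [set w | ~ V w]].

Let depth_le z w : ~ V w -> depth z <= Num.min 1 (mdist z w / d).
Proof.
move=> nw; apply: ge_inf; last by exists w.
exists 0 => _ [y _ <-]; rewrite le_min ler01/= divr_ge0 ?mdist_ge0//; exact: ltW.
Qed.

Let le_depth z r : (forall w, ~ V w -> r <= Num.min 1 (mdist z w / d)) -> r <= depth z.
Proof.
move=> h; apply: lb_le_inf; first by exists (Num.min 1 (mdist z x / d)), x.
by move=> _ [w nw <-]; exact: h.
Qed.

Let depth_ge0 z : 0 <= depth z.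
Proof.
by apply: le_depth => w _; rewrite le_min ler01/= divr_ge0 ?mdist_ge0//; exact: ltW.
Qed.

Let depth_le1 z : depth z <= 1.
Proof. by have := depth_le z nx; rewrite le_min => /andP[]. Qed.

Let depth_continuous : continuous depth.
Proof.
apply: (@lipschitz_continuous _ _ _ d^-1) => z y.
rewrite lerBlDr addrC -lerBlDr; apply: le_depth => w nw.
have := depth_le y nw; rewrite !le_min => /andP[h1 h2]; apply/andP; split.
  have : 0 <= d^-1 * mdist z y by rewrite mulr_ge0 ?mdist_ge0// invr_ge0 ltW.
  by lra.
have : mdist y w / d <= (mdist z y + mdist z w) / d.
  rewrite ler_pM2r ?invr_gt0// (metric_sym z y); exact: metric_triangle.
by rewrite mulrDl mulrC; lra.
Qed.

Let depth_eq0 z : ~ V z -> depth z = 0.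
Proof.
move=> nz; apply/eqP; rewrite eq_le depth_ge0 andbT.
by have := depth_le z nz; rewrite mdistxx mul0r le_min => /andP[].
Qed.

Let depth_eq1 z : (forall w, mdist z w < d -> V w) -> depth z = 1.
Proof.
move=> h; apply/eqP; rewrite eq_le depth_le1/=; apply: le_depth => w nw.
rewrite le_min lexx/= ler_pdivlMr// mul1r leNgt; by apply/negP => /h.
Qed.

(** A chain from [x] to [z], or no chain at all when [z = x], extends by one jump to every point of
    the [d]-ball around [Phi (z, t)]. *)
Let depth_flow z t : V z \/ z = x -> s <= t -> depth (Phi (z, t)) = 1.
Proof.
move=> Vz st; apply: depth_eq1 => w zw.
by case: Vz zw => [Vz|->] zw; [exact: has_chain_rcons zw|exact: has_chain1 zw].
Qed.

Let depth_mono z t : s <= t -> depth z <= depth (Phi (z, t)).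
Proof.
move=> st; have [Vz|/depth_eq0 ->] := pselect (V z); last exact: depth_ge0.
by rewrite (depth_flow _ st)//; left.
Qed.

(** Let [z] be reachable and [w] within [d] of it. A chain from [z] to itself of precision
    [d - mdist z w] ends with a jump from a reachable point that may be redirected to [w]; so the
    whole [d]-ball is reachable. *)
Let depth_chain_recurrent z : R z -> depth z = 0 \/ depth z = 1.
Proof.
move=> Rz; have [Vz|/depth_eq0 ->] := pselect (V z); last by left.
right; apply: depth_eq1 => w zw.
pose e := d - mdist z w.
have e0 : 0 < e by rewrite subr_gt0.
have ed : e <= d by have := mdist_ge0 z w; rewrite /e; lra.
have [|a [t [Va st at_]]] := has_chain_last Vz _ (Rz e s e0 s1).
  move=> a b t Va st ab; exact: has_chain_rcons Va st (lt_le_trans ab ed).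
apply: has_chain_rcons Va st _.
by have := metric_triangle (Phi (a, t)) z w; rewrite /e in at_; lra.
Qed.

(** [depth] is monotone only under times at least [s], while [h] may be shorter. Averaging over the
    iterates [j h] with [j < m] and [m h >= s] yields monotonicity under a single step. *)
Lemma escape_function (h : K) : 0 < h -> exists k : X -> K,
  [/\ continuous k, forall z, 0 <= k z <= 1, forall z, k z <= k (Phi (z, h)),
      k x < k (Phi (x, h))
    & forall C, C `<=` R -> connected C -> forall y z, C y -> C z -> k y = k z].
Proof.
move=> h0; pose m := (Num.truncn (s / h)).+1.
have sm : s <= m%:R * h.
  by rewrite -ler_pdivrMr//; exact/ltW/truncnS_gt.
have m0 : 0 < m%:R :> K by rewrite ltr0n.
pose k z := m%:R^-1 * \sum_(j < m) depth (Phi (z, j%:R * h)).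
(* The sum telescopes: one step of [k] costs [m] steps of [depth], a time to which [depth_mono] and
   [depth_flow] apply. *)
have kS z : k (Phi (z, h)) = k z + m%:R^-1 * (depth (Phi (z, m%:R * h)) - depth z).
  rewrite /k -mulrDr; congr (_ * _).
  transitivity (\sum_(j < m) depth (Phi (z, j.+1%:R * h))).
    apply: eq_bigr => j _; rewrite (flowD flowPhi) -[in RHS]natr1 mulrDl mul1r.
    by rewrite addrC.
  have := @big_ord_recl _ 0 +%R m (fun j : 'I_m.+1 => depth (Phi (z, j%:R * h))).
  rewrite big_ord_recr /= mul0r (flow0 flowPhi).
  under [in X in _ = _ + X -> _]eq_bigr do rewrite /bump /= add1n.
  by move=> e; rewrite addrA e addrAC subrr add0r.
exists k; split.
- move=> z; apply: cvgM; first exact: cvg_cst.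
  apply: cvg_big => [|j _]; first exact: add_continuous.
  apply: (@continuous_comp _ _ _ (fun z => Phi (z, j%:R * h)) depth).
    exact: flow_continuousl.
  exact: depth_continuous.
- move=> z; apply/andP; split.
    by rewrite mulr_ge0 ?invr_ge0// sumr_ge0.
  rewrite ler_pdivrMl// mulr1.
  have -> : m%:R = \sum_(j < m) (1 : K) by rewrite sumr_const card_ord.
  exact: ler_sum.
- move=> z; rewrite kS lerDl mulr_ge0 ?invr_ge0// subr_ge0; exact: depth_mono.
- rewrite kS ltrDl mulr_gt0 ?invr_gt0//.
  by rewrite (depth_flow _ sm) ?depth_eq0 ?subr0//; right.
- move=> C CR cC y z Cy Cz; congr (_ * _); apply: eq_bigr => j _.
  apply: (locally_constant_connected cC _ Cz Cy
    (f := fun z => depth (Phi (z, j%:R * h)))).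
  move=> a Ca; rewrite near_withinE.
  have cj : continuous (depth \o (fun z => Phi (z, j%:R * h))).
    by move=> b; apply: continuous_comp;
      [exact: flow_continuousl|exact: depth_continuous].
  (* By invariance of [R] each summand takes only the values 0 and 1 on [C]; values closer than one
     half coincide, so it is locally constant there. *)
  have half0 : (0 : K) < 2^-1 by lra.
  have /cvgrPdist_lt/(_ _ half0) := cj a.
  apply: filterS => b /= + Cb.
  have Rf c : C c -> R (Phi (c, j%:R * h)).
    by move=> /CR; exact: chain_recurrent_flow.
  case: (depth_chain_recurrent (Rf _ Ca)) => ->;
    by case: (depth_chain_recurrent (Rf _ Cb)) => ->;
      rewrite ?subr0 ?sub0r ?subrr ?normrN ?normr1//; lra.
Qed.

End Reachable.

Variables (h : K) (h0 : 0 < h).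

(** Strictness is required on [A] alone, which lets functions for different sets be combined; the
    bounds by 0 and 1 serve the convergence of a series. *)
Let conley_on (A : set X) (k : X -> K) :=
  [/\ continuous k, forall z, 0 <= k z <= 1, forall z, k z <= k (Phi (z, h)),
      forall z, A z -> k z < k (Phi (z, h))
    & forall C, C `<=` R -> connected C -> forall y z, C y -> C z -> k y = k z].

(** The set is closed, hence compact. An escape function is strict on a neighborhood of its point,
    and the mean of two functions is strict wherever one of them is. *)
Let conley_on_nochain (d s : K) : 0 < d -> 1 <= s ->
  exists k, conley_on [set x | ~ has_chain Phi d s x x] k.
Proof.
move=> d0 s1; set A := [set x | _].
pose P B := exists k, conley_on (A `&` B) k.
suff [k hk] : P A by exists k; rewrite setIid in hk.
have cA : closed A by rewrite -openC setCK; exact: open_has_chain.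
apply: (compact_set_ind (subclosed_compact cA compactX (@subsetT _ A))).
- exists (fun=> 0); split=> //; first by move=> z; exact: cvg_cst.
    by rewrite lexx ler01.
  by move=> z [].
- move=> B C BC [k [h1 h2 h3 h4 h5]]; exists k; split=> // z [Az Bz].
  by apply: h4; split=> //; exact: BC.
- move=> B C [k [h1 h2 h3 h4 h5]] [l [g1 g2 g3 g4 g5]].
  exists (fun z => 2^-1 * (k z + l z)); split.
  + by move=> z; apply: cvgM; [exact: cvg_cst|apply: cvgD; [exact: h1|exact: g1]].
  + by move=> z; have /andP[? ?] := h2 z; have /andP[? ?] := g2 z; lra.
  + by move=> z; have := h3 z; have := g3 z; lra.
  + move=> z [Az [Bz|Cz]].
      by have := h4 z (conj Az Bz); have := g3 z; lra.
    by have := g4 z (conj Az Cz); have := h3 z; lra.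
  + by move=> D DR cD y z Dy Dz; rewrite (h5 D DR cD y z)// (g5 D DR cD y z).
move=> x Ax; have [k [h1 h2 h3 h4 h5]] := escape_function d0 s1 Ax h0.
have ck : continuous (fun z => k (Phi (z, h)) - k z).
  move=> z; apply: cvgB; last exact: h1.
  by apply: (@continuous_comp _ _ _ (fun z => Phi (z, h)) k);
    [exact: flow_continuousl|exact: h1].
exists [set z | k z < k (Phi (z, h))]; last by exists k; split=> // z [].
have k0 : 0 < k (Phi (x, h)) - k x by rewrite subr_gt0.
have /cvgrPdist_lt/(_ _ k0) := ck x.
apply: filterS => z /=; rewrite ltr_norml => /andP[_]; rewrite -subr_gt0; lra.
Qed.

(** A point off [R] has no closed chain of precision [1 / (n + 1)] and time [n + 1] for some [n].
    The series of the corresponding functions with weights [2 ^- n.+1] is therefore strict at all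
    such points. *)
Lemma conley_function : exists L : X -> K,
  [/\ continuous L, forall z, L z <= L (Phi (z, h)),
      forall z, ~ R z -> L z < L (Phi (z, h))
    & forall C, C `<=` R -> connected C -> forall y z, C y -> C z -> L y = L z].
Proof.
have /choice[k hk] : forall n : nat, exists k,
    conley_on [set x | ~ has_chain Phi n.+1%:R^-1 n.+1%:R x x] k.
  by move=> n; apply: conley_on_nochain; rewrite ?invr_gt0 ?ltr0n// ler1n.
pose w n : K := 2 ^- n.+1.
have p2 n : 0 < 2 ^- n :> K by rewrite invr_gt0 exprn_gt0.
have w0 n : 0 < w n by exact: p2.
pose f N z := \sum_(n < N) w n * k n z.
have fS N z : f N.+1 z = f N z + w N * k N z by rewrite /f big_ord_recr.
(* The weights from [N] to [M - 1] add up to [2 ^- N - 2 ^- M]. *)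
have f_le N M z : (N <= M)%N -> f N z <= f M z <= f N z + 2 ^- N - 2 ^- M.
  move=> /subnK <-; elim: (M - N)%N => [|m /andP[IH1 IH2]].
    by rewrite add0n lexx/=; lra.
  rewrite addSn fS; have [_ /(_ z)/andP[k0 k1] _ _ _] := hk (m + N)%N.
  have wk0 : 0 <= w (m + N)%N * k (m + N)%N z by rewrite mulr_ge0// ltW.
  have wk1 : w (m + N)%N * k (m + N)%N z <= w (m + N)%N by rewrite ler_piMr// ltW.
  have e : 2 ^- (m + N) = w (m + N)%N + w (m + N)%N.
    by rewrite /w exprS invfM; field; rewrite expf_neq0.
  by rewrite -/(w (m + N)%N); apply/andP; split; lra.
pose S z := range (f ^~ z).
(* The partial sums increase and stay within [2 ^- N] of the supremum, uniformly in [z]; continuity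
   follows. *)
pose L z := sup (S z).
have supS z : has_sup (S z).
  split; first by exists (f 0%N z), 0%N.
  exists (f 0%N z + 1) => _ [N _ <-]; have /andP[_] := f_le 0%N N z (leq0n N).
  by have := p2 N; rewrite expr0 invr1; lra.
have fL N z : f N z <= L z by apply: ub_le_sup; [case: (supS z)|exists N].
have Lf z r : (forall N, f N z <= r) -> L z <= r.
  by move=> hr; apply: ge_sup; [case: (supS z)|move=> _ [N _ <-]].
have Lf2 N z : L z <= f N z + 2 ^- N.
  apply: Lf => M; have [NM|MN] := leqP N M.
    have /andP[_] := f_le N M z NM.
    by have := p2 M; lra.
  have /andP[h1 _] := f_le M N z (ltnW MN).
  by have := p2 N; lra.
have cf N : continuous (f N).
  move=> z; apply: cvg_big => [|n _]; first exact: add_continuous.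
  by apply: cvgM; [exact: cvg_cst|have [+ _ _ _ _] := hk n; exact].
have f_mono N z : f N z <= f N (Phi (z, h)).
  apply: ler_sum => n _; rewrite ler_wpM2l//; first exact: ltW.
  by have [_ _ + _ _] := hk n; exact.
exists L; split.
- move=> z; apply/cvgrPdist_lt => e e0.
  pose N := (Num.truncn (3 / e)).+1.
  have N2 : 2 ^- N < e / 3 :> K.
    rewrite -[e / 3]invrK invf_div ltf_pV2 ?posrE ?exprn_gt0 ?divr_gt0//.
    rewrite (lt_le_trans (truncnS_gt _))// -natrX ler_nat; exact/ltnW/ltn_expl.
  have e3 : 0 < e / 3 by lra.
  have /cvgrPdist_lt/(_ _ e3) := cf N z.
  apply: filterS => y; rewrite !ltr_norml.
  by have := fL N z; have := fL N y; have := Lf2 N z; have := Lf2 N y; lra.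
- by move=> z; apply: Lf => N; apply: le_trans (fL N _).
- move=> z nRz.
  have [n nz] : exists n : nat, ~ has_chain Phi n.+1%:R^-1 n.+1%:R z z.
    apply: contrapT => /forallNP hz; apply: nRz => d s d0 s1.
    pose n := maxn (Num.truncn d^-1) (Num.truncn s).
    apply: has_chain_sub (contrapT (hz n)).
      rewrite -[d]invrK lef_pV2 ?posrE ?ltr0n ?invr_gt0//.
      by rewrite (le_trans (ltW (truncnS_gt _)))// ler_nat ltnS leq_maxl.
    by rewrite (le_trans (ltW (truncnS_gt _)))// ler_nat ltnS leq_maxr.
  have [_ _ kmono kz _] := hk n.
  have c0 : 0 < w n * (k n (Phi (z, h)) - k n z).
    by rewrite mulr_gt0// subr_gt0; exact: kz.
  (* Strictness survives the limit since the gain of the [n]-th term is independent of [N] and no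
     other term decreases. Below, [M] is large enough for that term to occur in the sum. *)
  suff : L z <= L (Phi (z, h)) - w n * (k n (Phi (z, h)) - k n z) by lra.
  apply: Lf => N; rewrite lerBrDr; pose M := maxn N n.+1.
  have /andP[NM _] := f_le N M z (leq_maxl _ _).
  suff : f M z + w n * (k n (Phi (z, h)) - k n z) <= f M (Phi (z, h)).
    by have := fL M (Phi (z, h)); lra.
  have nM : (n < M)%N by rewrite leq_maxr.
  rewrite /f (bigD1 (Ordinal nM))//= [leRHS](bigD1 (Ordinal nM))//=.
  suff : \sum_(i < M | i != Ordinal nM) w i * k i z <=
      \sum_(i < M | i != Ordinal nM) w i * k i (Phi (z, h)) by lra.
  apply: ler_sum => i _; rewrite ler_wpM2l//; first exact: ltW.
  by have [_ _ + _ _] := hk i; exact.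
- move=> C CR cC y z Cy Cz; rewrite /L /S; congr sup.
  suff -> : (f ^~ y) = (f ^~ z) by [].
  apply/funext => N; apply: eq_bigr => n _; congr (_ * _).
  by have [_ _ _ _ hc] := hk n; exact: (hc C).
Qed.

End ConleyFunction.

(** * Invariance and closedness of the chain recurrent set *)

Section RecurrentSet.
Context {K : realType} {X : metricType K} (Phi : X * K -> X).
Hypotheses (flowPhi : is_flow Phi) (compactX : compact [set: X]).
Let R := chain_recurrent_set Phi.

Lemma not_chain_recurrent_flow x t : ~ R x -> ~ R (Phi (x, t)).
Proof.
apply: contra_not => /(chain_recurrent_flow flowPhi (- t) compactX).
by rewrite (flowD flowPhi) subrr (flow0 flowPhi).
Qed.

Lemma orbit_chain_recurrent x (a b : K) :
  R x -> (fun t => Phi (x, t)) @` `[a, b] `<=` R.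
Proof. by move=> Rx _ [t _ <-]; exact: chain_recurrent_flow. Qed.

(** [R] is where the function of [conley_function] for step 1 does not increase: an orbit segment in
    [R] is connected, so the function is constant on it. *)
Lemma closed_chain_recurrent_set : closed R.
Proof.
have [L [cL Lmono Lstrict Lconst]] := conley_function flowPhi compactX ltr01.
have -> : R = [set z | L (Phi (z, 1)) - L z <= 0].
  apply/seteqP; split=> z /=.
    move=> Rz; rewrite subr_le0.
    rewrite (Lconst _ (@orbit_chain_recurrent z 0 1 Rz)
      (@orbit_connected _ _ _ flowPhi z 0 1) (Phi (z, 1)) z)//.
      by exists 1; rewrite //= in_itv /= ler01 lexx.
    by exists 0; rewrite ?(flow0 flowPhi)//= in_itv /= ler01 lexx.
  by rewrite leNgt => /negP nL; apply: contrapT => /Lstrict; rewrite -subr_gt0.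
apply: ((continuous_closedP (fun z => L (Phi (z, 1)) - L z)).1 _ [set r : K | r <= 0]).
  move=> z; apply: cvgB; last exact: cL.
  by apply: (@continuous_comp _ _ _ (fun z => Phi (z, 1)) L);
    [exact: flow_continuousl|exact: cL].
exact: closed_le.
Qed.

End RecurrentSet.

(** * Averages along orbits *)

Section SegmentIntegral.
Context {K : realType}.
Notation mu := (@lebesgue_measure K).
Implicit Types (f : K -> K) (a b c t : K).

Lemma continuous_segment_integrable f a b : {within `[a, b], continuous f} ->
  mu.-integrable `[a, b] (EFin \o f).
Proof.
by move=> cf; apply: continuous_compact_integrable => //; exact: segment_compact.
Qed.

Lemma Rintegral_segment_cst a b (r : K) : a <= b ->
  \int[mu]_(x in `[a, b]) r = r * (b - a).
Proof.
move=> ab; rewrite Rintegral_cst//= lebesgue_measure_itv/= lte_fin.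
by move: ab; rewrite le_eqVlt => /predU1P[->|->//]; rewrite ltxx subrr.
Qed.

Lemma Rintegral_split f a b c : a <= b <= c -> {within `[a, c], continuous f} ->
  \int[mu]_(x in `[a, c]) f x =
  \int[mu]_(x in `[a, b]) f x + \int[mu]_(x in `[b, c]) f x.
Proof.
move=> /andP[ab bc] cf; have itf := continuous_segment_integrable cf.
have := @Rintegral_itvB K f (BLeft a) (BRight c) b itf.
rewrite !bnd_simp => /(_ ab bc) /eqP; rewrite subr_eq addrC => /eqP ->.
rewrite Rintegral_itv_obnd_cbnd//; apply: integrableS itf => //.
by move=> x /=; rewrite !in_itv/= => /andP[bx ->]; rewrite (le_trans ab (ltW bx)).
Qed.

Lemma continuous_shift_within f (A : set K) t : {within A, continuous f} ->
  {within [set s | A (s + t)], continuous (fun s => f (s + t))}.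
Proof.
move=> /subspace_continuousP cf; apply/subspace_continuousP => x /= Ax W /(cf _ Ax) nW.
have cs : {for x, continuous (fun s : K => s + t)}.
  by apply: cvgD; [exact: cvg_id|exact: cvg_cst].
exact: (near_comp cs nW).
Qed.

Lemma Rintegral_shift f a b t : a <= b -> {within `[a + t, b + t], continuous f} ->
  \int[mu]_(s in `[a, b]) f (s + t) = \int[mu]_(s in `[a + t, b + t]) f s.
Proof.
move=> ab cf; rewrite /Rintegral; congr fine.
have d1 (s : K) : derivable (fun s : K => s + t) s 1 by [].
have D1 : derive1 (fun s : K => s + t) = cst 1.
  by apply/funext => s; rewrite derive1E deriveD// derive_id derive_cst addr0.
rewrite (@integration_by_substitution_increasing _ (fun s : K => s + t))//.
- by rewrite D1; under [RHS]eq_integral do rewrite /= mulr1.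
- by move=> x y _ _ xy; rewrite ltrD2r.
- by rewrite D1 => s _; exact: cvg_cst.
- by rewrite D1; exact: is_cvg_cst.
- by rewrite D1; exact: is_cvg_cst.
- split=> //.
    by apply: cvg_at_right_filter; apply: cvgD; [exact: cvg_id|exact: cvg_cst].
  by apply: cvg_at_left_filter; apply: cvgD; [exact: cvg_id|exact: cvg_cst].
Qed.

(** The maximum of [f] is negative and bounds the mean value. *)
Lemma Rintegral_lt0 f a b : a < b -> {within `[a, b], continuous f} ->
  (forall x, x \in `[a, b] -> f x < 0) -> \int[mu]_(x in `[a, b]) f x < 0.
Proof.
move=> ab cf f0; have [c cab fc] := EVT_max (ltW ab) cf.
have m0 : f c * (b - a) < 0 by rewrite nmulr_rlt0 ?subr_gt0//; exact: f0.
apply: le_lt_trans m0; rewrite -(Rintegral_segment_cst _ (ltW ab)).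
apply: le_Rintegral => //; first exact: continuous_segment_integrable.
by apply: continuous_segment_integrable => x; exact: cvg_cst.
Qed.

(** Splitting the integral over [[0, c + h]] at [c] and at [h] shows that the difference of the two
    sides is the integral of [f (s + h) - f s] over [[0, c]]; [c] and [h] need not be compared. *)
Lemma Rintegral_window_lt f h c : 0 < h -> 0 < c ->
  {within `[0, c + h], continuous f} ->
  (forall s, 0 <= s <= c -> f (s + h) < f s) ->
  \int[mu]_(s in `[0, h]) f (s + c) < \int[mu]_(s in `[0, h]) f s.
Proof.
move=> h0 c0 cf fh.
have sub a b : 0 <= a -> b <= c + h -> {within `[a, b], continuous f}.
  move=> a0 bch; apply: continuous_subspaceW cf => x /=; rewrite !in_itv/=.
  by move=> /andP[ax xb]; rewrite (le_trans a0 ax) (le_trans xb bch).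
have cch : 0 <= c <= c + h by rewrite lerDl !ltW.
have hch : 0 <= h <= c + h by rewrite lerDr !ltW.
have e1 := Rintegral_split cch cf; have e2 := Rintegral_split hch cf.
have cf0 : {within `[0, c], continuous f} by apply: sub; rewrite ?lexx// lerDl ltW.
have cfh : {within `[0, c], continuous (fun s => f (s + h))}.
  have : {within `[0 + h, c + h], continuous f} by apply: sub; rewrite ?add0r// ltW.
  move=> /(@continuous_shift_within _ _ h); apply: continuous_subspaceW => s /=.
  by rewrite !in_itv/= !lerD2r.
have : \int[mu]_(s in `[0, c]) (f (s + h) - f s) < 0.
  apply: Rintegral_lt0 => //.
    by move=> x; apply: cvgB; [exact: cfh|exact: cf0].
  by move=> s; rewrite in_itv/= subr_lt0; exact: fh.
rewrite RintegralB//; [|exact: continuous_segment_integrable..].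
have ch0 : {within `[0 + h, c + h], continuous f}.
  by apply: sub; rewrite ?add0r// ltW.
have hc0 : {within `[0 + c, h + c], continuous f}.
  by apply: sub; rewrite ?add0r 1?addrC// ltW.
rewrite (Rintegral_shift (ltW c0) ch0) (Rintegral_shift (ltW h0) hc0) !add0r.
by rewrite [h + c]addrC; lra.
Qed.
End SegmentIntegral.

(** * Averages of a function over orbit segments of fixed length *)

Section OrbitAverage.
Context {K : realType} {X : metricType K} (Phi : X * K -> X).
Hypothesis flowPhi : is_flow Phi.
Variables (h : K) (h0 : 0 < h).
Notation mu := (@lebesgue_measure K).
Implicit Types (W : set X) (g : X -> K) (x : X).

Definition orbit_average g x : K := h^-1 * \int[mu]_(s in `[0, h]) g (Phi (x, s)).

Lemma continuous_along_orbit W g x a b : (forall y, W y -> {for y, continuous g}) ->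
  (forall s, a <= s <= b -> W (Phi (x, s))) ->
  {within `[a, b], continuous (fun s => g (Phi (x, s)))}.
Proof.
move=> cg xW; apply/subspace_continuousP => s /=; rewrite in_itv/= => sab.
apply: cvg_within_filter.
apply: (@continuous_comp _ _ _ (fun s => Phi (x, s)) g).
  exact: flow_continuousr.
exact: cg (xW s sab).
Qed.

Lemma orbit_average_cst g x r : (forall s, 0 <= s <= h -> g (Phi (x, s)) = r) ->
  orbit_average g x = r.
Proof.
move=> gr; rewrite /orbit_average (_ : \int[mu]_(s in _) _ = r * (h - 0)).
  by rewrite subr0 mulrCA mulVf ?mulr1// gt_eqF.
rewrite -(Rintegral_segment_cst _ (ltW h0)); apply: eq_Rintegral => s.
by rewrite inE/= in_itv/=; exact: gr.
Qed.

Lemma orbit_averageD W g k x r : (forall y, W y -> {for y, continuous g}) ->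
  (forall s, 0 <= s <= h -> W (Phi (x, s))) ->
  (forall s, 0 <= s <= h -> k (Phi (x, s)) = g (Phi (x, s)) + r) ->
  orbit_average k x = orbit_average g x + r.
Proof.
move=> cg xW kg; rewrite /orbit_average.
have -> : \int[mu]_(s in `[0, h]) k (Phi (x, s)) =
    \int[mu]_(s in `[0, h]) (g (Phi (x, s)) + r).
  by apply: eq_Rintegral => s; rewrite inE/= in_itv/=; exact: kg.
rewrite RintegralD//.
- rewrite (Rintegral_segment_cst _ (ltW h0)) mulrDr subr0; congr (_ + _).
  by rewrite mulrCA mulVf ?mulr1// gt_eqF.
- exact: continuous_segment_integrable (continuous_along_orbit cg xW).
- by apply: continuous_segment_integrable => s; exact: cvg_cst.
Qed.

(** Moving the base point by [c] moves the window of integration by [c]; this is the derivative of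
    the moving average in integrated form. *)
Lemma orbit_average_lt W g x c : 0 < c -> (forall y, W y -> {for y, continuous g}) ->
  (forall s, 0 <= s <= c + h -> W (Phi (x, s))) ->
  (forall s, 0 <= s <= c -> g (Phi (x, s + h)) < g (Phi (x, s))) ->
  orbit_average g (Phi (x, c)) < orbit_average g x.
Proof.
move=> c0 cg xW gh; rewrite /orbit_average ltr_pM2l ?invr_gt0//.
under eq_Rintegral do rewrite (flowD flowPhi) addrC.
exact: (Rintegral_window_lt h0 c0 (continuous_along_orbit cg xW)).
Qed.

Lemma orbit_average_continuous W g x : open W ->
  (forall y, W y -> {for y, continuous g}) ->
  (forall s, 0 <= s <= h -> W (Phi (x, s))) ->
  {for x, continuous (orbit_average g)}.
Proof.
move=> oW cg xW; apply/cvgrPdist_lt => e e0.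
have e2 : 0 < e / 2 by rewrite divr_gt0.
have e4 : 0 < e / 4 by rewrite divr_gt0.
pose P y s := `|g (Phi (x, s)) - g (Phi (y, s))| < e / 2.
have cov := (compact_near_coveringP _).1 (@segment_compact K 0 h) X (nbhs x) P _.
have nW := near_orbit_sub flowPhi oW xW.
(* Compactness of [[0, h]] makes the estimate uniform in time. At a time [u] near [s] both orbits
   are compared with [Phi (x, s)], hence the bound [e / 4]. *)
have {cov} : \forall y \near x, `[0, h]%classic `<=` P y.
  apply: cov => s /=; rewrite in_itv/= => sh.
  have /cvgrPdist_lt/(_ _ e4) : {for (x, s), continuous (g \o Phi)}.
    apply: continuous_comp; first exact: flow_continuous.
    exact: cg (xW s sh).
  move=> [[A B] /= [nA nB] AB]; exists (B, A) => //= -[u y] /= [Bu Ay].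
  have /= := AB (y, u) (conj Ay Bu).
  have /= := AB (x, u) (conj (nbhs_singleton nA) Bu).
  by rewrite /P !ltr_norml; lra.
apply: filterS2 nW => y yW gxy.
rewrite /orbit_average -mulrBr.
have ix := continuous_segment_integrable (continuous_along_orbit cg xW).
have iy := continuous_segment_integrable (continuous_along_orbit cg yW).
have i2 : mu.-integrable `[0, h] (EFin \o cst (e / 2)).
  by apply: continuous_segment_integrable => s; exact: cvg_cst.
have hh : h^-1 * (e / 2 * (h - 0)) < e.
  by rewrite subr0 mulrCA mulVf ?mulr1 ?gt_eqF//; lra.
apply: le_lt_trans hh; rewrite normrM ger0_norm ?invr_ge0 ?(ltW h0)//.
rewrite ler_pM2l ?invr_gt0// -RintegralB//.
have ixy : mu.-integrable `[0, h]
    (EFin \o (fun s => g (Phi (x, s)) - g (Phi (y, s)))).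
  rewrite (_ : _ \o _ = ((EFin \o (fun s => g (Phi (x, s)))) \-
    (EFin \o (fun s => g (Phi (y, s)))))%E) //.
  exact: integrableB.
apply: le_trans (le_normr_Rintegral _ ixy) _ => //.
rewrite -(Rintegral_segment_cst _ (ltW h0)); apply: le_Rintegral => //.
- exact: (integrable_norm ixy).
- by move=> s sh; exact/ltW/gxy.
Qed.

End OrbitAverage.

(** * Potentials of a Cech class vanishing near a closed set *)

Lemma near_eq_continuous (S T : topologicalType) (f g : S -> T) x :
  (\forall y \near x, f y = g y) -> {for x, continuous g} -> {for x, continuous f}.
Proof.
move=> fg cg W; rewrite (nbhs_singleton fg) => /cg; apply: filterS2 fg.
by move=> y /= ->.
Qed.

Section Potentials.
Context {K : realType} {X : metricType K}.
Hypothesis compactX : compact [set: X].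

Section Primitives.
Variables (A : set X) (W : X -> set X) (e : X -> X -> X -> K).
Hypotheses
  (oW : forall p, open (W p)) (Wp : forall p, W p p)
  (eD : forall p q r x, W p x -> W q x -> W r x -> e p q x + e q r x = e p r x)
  (e_lc : forall p q x, W p x -> W q x -> \forall y \near x, e p q y = e p q x)
  (eA : forall p q x, A p -> A q -> W p x -> W q x -> e p q x = 0)
  (WA : forall p x, ~ A p -> A x -> ~ W p x).

(** A partition of unity splits the cocycle [e]. By [eA] and [WA], near [A] only bumps centred in
    [A] are present, and between two such centres [e] vanishes; this makes the primitives locally
    constant there. *)
Lemma adapted_primitives : exists (phi : X -> X -> K) (N : set X),
  [/\ forall p x, W p x -> {for x, continuous (phi p)},
      forall p q x, W p x -> W q x -> phi q x - phi p x = e p q x,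
      open N, A `<=` N
    & forall p x, N x -> W p x -> \forall y \near x, phi p y = phi p x].
Proof.
have /choice[s hs] : forall p, exists s : K,
    0 < s /\ forall x, mdist p x < s -> W p x.
  move=> p; have /nbhs_mdistP[s s0 hs] := open_nbhs_nbhs (conj (oW p) (Wp p)).
  by exists s.
have s0 p : 0 < s p by case: (hs p).
have sW p x : mdist p x < s p -> W p x by case: (hs p) => _; exact.
have [D covD] : exists D : seq X, forall x, setT x ->
    exists2 k, k \in D & mdist k x < s k / 2.
  apply: (compact_set_ind (P := fun B => exists D : seq X, forall x, B x ->
    exists2 k, k \in D & mdist k x < s k / 2) compactX).
  - by exists [::].
  - by move=> B C BC [D hD]; exists D => x /BC; exact: hD.
  - move=> B C [D hD] [E hE]; exists (D ++ E) => x [/hD|/hE] [k kD kx].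
      by exists k => //; rewrite mem_cat kD.
    by exists k => //; rewrite mem_cat kD orbT.
  - move=> x _; exists [set y | mdist x y < s x / 2].
      by apply: near_mdist; rewrite divr_gt0.
    by exists [:: x] => y xy; exists x => //; rewrite mem_head.
(* Half the radius leaves a margin: [mu k] vanishes near every point outside the ball of radius
   [s k]. *)
pose mu k x := Num.max 0 (s k / 2 - mdist k x).
have mu_ge0 k x : 0 <= mu k x by rewrite le_max lexx.
have mu_eq0 k x : s k / 2 <= mdist k x -> mu k x = 0.
  by move=> kx; apply/max_idPl; rewrite subr_le0.
have mu_gt0 k x : mdist k x < s k / 2 -> 0 < mu k x.
  by move=> kx; rewrite lt_max subr_gt0 kx orbT.
have mu_W k x : mu k x != 0 -> W k x.
  move=> muk; apply: sW; have [kx|/mu_eq0 e0] := ltP (mdist k x) (s k / 2).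
    by have := s0 k; lra.
  by rewrite e0 eqxx in muk.
have cmu k : continuous (mu k).
  apply: (@lipschitz_continuous _ _ _ 1) => x y; rewrite mul1r lerBlDr ge_max.
  apply/andP; split; first by rewrite addr_ge0// mdist_ge0.
  have : s k / 2 - mdist k x <= mu k x by rewrite le_max lexx orbT.
  by have := metric_triangle k y x; rewrite (metric_sym y x); lra.
pose S x := \sum_(k <- D) mu k x.
have S0 x : 0 < S x.
  rewrite lt_neqAle sumr_ge0 ?andbT// eq_sym /S psumr_eq0//.
  have [k kD kx] := covD x I; apply/allPn; exists k => //.
  by rewrite /= gt_eqF// mu_gt0.
have cS : continuous S.
  by move=> x; apply: cvg_big => [|k _]; [exact: add_continuous|exact: cmu].
(* The values of [e k p] off [W k] are uncontrolled, but [mu k] is zero there. *)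
pose phi p x := (\sum_(k <- D) mu k x * e k p x) / S x.
have phiB p q x : W p x -> W q x -> phi q x - phi p x = e p q x.
  move=> px qx; rewrite -mulrBl -sumrB.
  apply: (canLR (mulfK _)); first by rewrite gt_eqF.
  rewrite mulr_sumr; apply: eq_bigr => k _; rewrite -mulrBr mulrC.
  have [->|/mu_W kx] := eqVneq (mu k x) 0; first by rewrite ?mulr0 ?mul0r.
  by rewrite -(eD kx px qx); ring.
(* The complement of the finitely many closed half-radius balls centred off [A]. *)
pose N : set X := [set x | forall k, k \in D -> ~ A k -> s k / 2 < mdist k x].
have phi0 p x : N x -> A p -> W p x -> phi p x = 0.
  move=> Nx Ap px; rewrite /phi big_seq big1 ?mul0r// => k kD.
  have [->|/[dup]/mu_W kx muk] := eqVneq (mu k x) 0; first by rewrite mul0r.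
  have [Ak|nAk] := pselect (A k); first by rewrite eA// mulr0.
  by rewrite mu_eq0 ?mul0r// ltW//; exact: Nx.
have oN : open N.
  rewrite openE => x Nx; rewrite /interior /N.
  suff : forall E : seq X, {subset E <= D} -> \forall y \near x,
      forall k, k \in E -> ~ A k -> s k / 2 < mdist k y by move=> /(_ D); apply.
  elim=> [_|k E IH ED]; first by apply: nearW.
  have {IH} := IH (fun z zE => ED z (mem_behead (s := k :: E) zE)).
  have [Ak|nAk] := pselect (A k).
    by apply: filterS => y hy j; rewrite inE => /predU1P[->|/hy].
  have := near_mdist_gt (Nx k (ED k (mem_head _ _)) nAk).
  by apply: filterS2 => y ky hy j; rewrite inE => /predU1P[->|/hy].
exists phi, N; split=> //.
- move=> p x px; apply: cvgM; last by apply: cvgV; [rewrite gt_eqF|exact: cS].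
  apply: cvg_big => [|k _]; first exact: add_continuous.
  have [kx|kx] := ltP (mdist k x) (s k).
    apply: (near_eq_continuous (g := fun y => mu k y * e k p x)).
      by apply: filterS (e_lc (sW _ _ kx) px) => y ->.
    by apply: cvgM; [exact: cmu|exact: cvg_cst].
  have kx' : s k / 2 < mdist k x by have := s0 k; lra.
  have term0 : \forall y \near x, mu k y * e k p y = 0.
    by apply: filterS (near_mdist_gt kx') => y /ltW/mu_eq0 ->; rewrite mul0r.
  exact: near_eq_continuous term0 (cvg_cst _).
- move=> x Ax k _ nAk; rewrite ltNge; apply/negP => kx; apply: (WA nAk Ax).
  by apply: sW; have := s0 k; lra.
(* A bump that is positive at a point of [N] has its centre [k] in [A]. There [phi k] vanishes, so
   [phi p] equals the locally constant [e k p]. *)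
- move=> p x Nx px; have [k kD kx] := covD x I.
  have Ak : A k.
    apply: contrapT => nAk; have := Nx k kD nAk; by rewrite ltNge ltW.
  have Wk : W k x by apply: sW; have := s0 k; lra.
  have nN := open_nbhs_nbhs (conj oN Nx).
  have nk := open_nbhs_nbhs (conj (oW k) Wk).
  have np := open_nbhs_nbhs (conj (oW p) px).
  have phip y : N y -> W k y -> W p y -> phi p y = e k p y.
    by move=> Ny ky py; rewrite -(phiB k p y ky py) (phi0 k y Ny Ak ky) subr0.
  apply: filterS (filterI (filterI nk np) (filterI nN (e_lc Wk px))).
  by move=> y [[ky py] [Ny ey]]; rewrite !phip.
Qed.

End Primitives.
End Potentials.

(** * Cocycles on the whole space and covers adapted to a closed set *)

Section CechCocycle.
Context {K : realType} {T : topologicalType}.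
Variable c : cech_cocycle K [set: T].

Lemma coef_xx U x : cech_cover c U -> U x -> coef c U U x = 0.
Proof.
by move=> cU Ux; have := coef_cocycle cU cU cU I Ux Ux Ux; lra.
Qed.

Lemma coefC U V x : cech_cover c U -> cech_cover c V -> U x -> V x ->
  coef c V U x = - coef c U V x.
Proof.
move=> cU cV Ux Vx; have := coef_cocycle cU cV cU I Ux Vx Ux.
by rewrite coef_xx//; lra.
Qed.

Lemma coef_connected U V B x y : cech_cover c U -> cech_cover c V -> connected B ->
  B `<=` U -> B `<=` V -> B x -> B y -> coef c U V y = coef c U V x.
Proof.
move=> cU cV cB BU BV Bx By; apply: (locally_constant_connected cB _ Bx By).
apply: locally_constant_sub (coef_locally_constant cU cV) => z Bz.
by split; [split=> //; exact: BU|exact: BV].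
Qed.

Lemma near_coef U V x : cech_cover c U -> cech_cover c V -> U x -> V x ->
  \forall y \near x, coef c U V y = coef c U V x.
Proof.
move=> cU cV Ux Vx; have [oc _] := cech_coverP c.
have : \forall y \near within ([set: T] `&` U `&` V) (nbhs x),
    coef c U V y = coef c U V x by exact: coef_locally_constant.
rewrite near_withinE; have nU := open_nbhs_nbhs (conj (oc _ cU) Ux).
have nV := open_nbhs_nbhs (conj (oc _ cV) Vx).
by apply: filterS3 nU nV => y Uy Vy; apply.
Qed.

End CechCocycle.

Section AdaptedCover.
Context {K : realType} {X : metricType K}.
Hypothesis lpcX : locally_path_connected K X.
Variables (A : set X) (c : cech_cocycle K [set: X]).
Hypothesis closedA : closed A.

(* [W p] is so small, and connected, that for [q] in [A] with the smaller
   radius the whole of [W q] lies in [U p]; hence the value of the cocycle on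
   [W p `&` W q] is its value at the point [q] of [A]. *)
Lemma adapted_cover :
  cech_restr (@subsetT _ A) (\pi_(cech_H1 K [set: X]) c)%qT = cech_zero K A ->
  exists (W U : X -> set X) (b : X -> K),
  [/\ forall p, [/\ open (W p), W p p, cech_cover c (U p) & W p `<=` U p],
      forall p q x, A p -> A q -> W p x -> W q x ->
        coef c (U p) (U q) x = b q - b p
    & forall p x, ~ A p -> A x -> ~ W p x].
Proof.
rewrite cech_restr_pi => /cech_H1_eqP[C [r [r' [hh [[oC cC] rC _ lh eh]]]]].
rewrite /= in rC eh.
have [oc cc] := cech_coverP c.
(* The components of [t] are, in order, [W p], [U p], [b p], a radius, and the member of [C]
   refining [U p] on [A]. For [p] off [A] the last three are placeholders. *)
pose good p (t : set X * set X * (K * K) * set X) :=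
  [/\ open t.1.1.1, t.1.1.1 p, cech_cover c t.1.1.2 & t.1.1.1 `<=` t.1.1.2] /\
  (~ A p -> forall x, A x -> ~ t.1.1.1 x) /\
  (A p -> [/\ connected t.1.1.1, forall x, t.1.1.1 x -> mdist p x < t.1.2.2 / 4,
    forall x, mdist p x < t.1.2.2 -> t.1.1.2 x,
    C t.2 /\ t.1.1.2 = r t.2 &
    forall x, A x -> mdist p x < t.1.2.2 -> t.2 x /\ hh t.2 x = t.1.2.1]).
have /choice[t ht] : forall p, exists t, good p t.
  move=> p; have [Ap|nAp] := pselect (A p); last first.
    have [U cU Up] := cc p I.
    exists ((U `&` ~` A, U), (0, 0), set0); split; last first.
      by split=> // _ x Ax [_]; exact.
    split=> //; last by move=> x [].
    by apply: openI; [exact: oc|exact: closed_openC].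
  have [Z CZ Zp] := cC p Ap; have [crZ rZ] := rC Z CZ.
  have Up : r Z p by exact: rZ.
  have nZ := open_nbhs_nbhs (conj (oC _ CZ) Zp).
  have nU := open_nbhs_nbhs (conj (oc _ crZ) Up).
  have := lh Z CZ p (conj Ap Zp); rewrite near_withinE => nh.
  have /nbhs_mdistP[rho rho0 hrho] : nbhs p
      [set y | (Z y /\ r Z y) /\ ((A `&` Z) y -> hh Z y = hh Z p)].
    exact: filterI (filterI nZ nU) nh.
  have rho4 : 0 < rho / 4 by rewrite divr_gt0.
  have [V [oV Vp Vsub pV]] := lpcX (near_mdist p rho4).
  exists ((V, r Z), (hh Z p, rho), Z); split=> /=.
    split=> // x /Vsub /= px.
    by have [|[]] := hrho x; first by lra.
  split=> // _; split=> //.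
  - exact: path_connected_connected pV.
  - by move=> x /hrho[[]].
  - by move=> x Ax /hrho[[Zx Ux] hx]; split=> //; exact: hx.
pose W p := (t p).1.1.1; pose U p := (t p).1.1.2; pose b p := (t p).1.2.1.
have hWU p : [/\ open (W p), W p p, cech_cover c (U p) & W p `<=` U p].
  by case: (ht p).
exists W, U, b; split=> //; last by move=> p x nAp Ax; case: (ht p) => _ [/(_ nAp x Ax)].
(* Both [W p] and [W q] lie within a quarter of the respective radii, so [W q] stays within three
   quarters of the larger radius from [p], hence inside [U p]. *)
have main p q x : (t q).1.2.2 <= (t p).1.2.2 -> A p -> A q -> W p x -> W q x ->
    coef c (U p) (U q) x = b q - b p.
  move=> qp Ap Aq px qx.
  have [_ [_ /(_ Ap)[_ pW pU [Cp Up] ph]]] := ht p.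
  have [_ [_ /(_ Aq)[cq qW qU [Cq Uq] qh]]] := ht q.
  have [_ _ cUp WUp] := hWU p; have [_ Wqq cUq WUq] := hWU q.
  have dpx := pW x px; have dqx := qW x qx.
  have dpq : mdist p q < (t p).1.2.2 / 2.
    by have := metric_triangle p x q; rewrite (metric_sym x q); lra.
  have rp : 0 <= (t p).1.2.2 by have := mdist_ge0 p x; lra.
  have WqUp : W q `<=` U p.
    move=> y /qW qy; apply: pU.
    by have := metric_triangle p q y; lra.
  rewrite (@coef_connected _ _ _ (U p) (U q) (W q) q x)//.
  (* At the point [q] of [A] the cocycle is the coboundary of [hh], whose two values there are [b p]
     and [b q]. *)
  have [|Zp hp] := ph q Aq; first by lra.
  have rq : 0 < (t q).1.2.2 by have := mdist_ge0 q x; lra.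
  have [Zq hq] : (t q).2 q /\ hh (t q).2 q = b q.
    by apply: qh; rewrite ?mdistxx.
  have := eh _ _ q Cp Cq Aq Zp Zq.
  by rewrite -Up -Uq subr0 hq hp.
move=> p q x Ap Aq px qx; have [qp|pq] := leP (t q).1.2.2 (t p).1.2.2.
  exact: main.
have [_ _ cUp WUp] := hWU p; have [_ _ cUq WUq] := hWU q.
rewrite coefC//; [|exact: WUq|exact: WUp].
by rewrite (main q p x (ltW pq))//; ring.
Qed.

End AdaptedCover.

(** * Lyapunov one-forms *)

(** The cover of a [form_family] is a set of subsets, so indices with equal [V i] are merged and one
    of their potentials is chosen. *)
Lemma indexed_form_family (K : realType) (T : topologicalType) (I : Type)
    (V : I -> set T) (psi : I -> T -> K) :
  (forall i, open (V i)) -> (forall x, exists i, V i x) ->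
  (forall i x, V i x -> {for x, continuous (psi i)}) ->
  (forall i j x, V i x -> V j x ->
     \forall y \near x, psi i y - psi j y = psi i x - psi j x) ->
  exists F : form_family K [set: T],
    forall Z, form_cover F Z -> exists i, Z = V i /\ pot F Z = psi i.
Proof.
move=> oV cV cpsi lc.
have /choice[f hf] : forall Z, exists f : T -> K,
    range V Z -> exists i, Z = V i /\ f = psi i.
  move=> Z; have [[i _ <-]|nZ] := pselect (range V Z); last by exists (fun=> 0).
  by exists (psi i) => _; exists i.
have covV : is_open_cover [set: T] (range V).
  split=> [_ [i _ <-] //|x _]; have [i Vi] := cV x.
  by exists (V i) => //; exists i.
have cf Z : range V Z -> {within [set: T] `&` Z, continuous (f Z)}.
  rewrite setTI => /hf[i [-> ->]]; apply/subspace_continuousP => x Vx.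
  apply: cvg_within_filter; exact: cpsi.
have lcf Z Z' : range V Z -> range V Z' ->
    locally_constant ([set: T] `&` Z `&` Z') (fun x => f Z x - f Z' x).
  move=> /hf[i [-> ->]] /hf[j [-> ->]] x [[_ Vi] Vj]; rewrite near_withinE.
  by apply: filterS (lc i j x Vi Vj) => y.
by exists (FormFamily covV cf lcf).
Qed.

Section AdaptedPotentials.
Context {K : realType} {X : metricType K}.
Hypotheses (compactX : compact [set: X]) (lpcX : locally_path_connected K X).
Variables (A : set X) (c : cech_cocycle K [set: X]).
Hypothesis closedA : closed A.

(** Subtracting the coboundary of [b] from the cocycle makes it vanish between members centred in
    [A], as [adapted_primitives] requires. *)
Lemma adapted_potentials :
  cech_restr (@subsetT _ A) (\pi_(cech_H1 K [set: X]) c)%qT = cech_zero K A ->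
  exists (W U : X -> set X) (b : X -> K) (phi : X -> X -> K) (N : set X),
  [/\ forall p, [/\ open (W p), W p p, cech_cover c (U p) & W p `<=` U p],
      forall p x, W p x -> {for x, continuous (phi p)},
      forall p q x, W p x -> W q x ->
        phi q x - phi p x = coef c (U p) (U q) x - (b q - b p),
      open N /\ A `<=` N
    & forall p x, N x -> W p x -> \forall y \near x, phi p y = phi p x].
Proof.
move=> /(adapted_cover lpcX closedA)[W [U [b [hW cb WA]]]].
pose e p q x := coef c (U p) (U q) x - (b q - b p).
have WU p x : W p x -> U p x by case: (hW p) => _ _ _; exact.
have cU p : cech_cover c (U p) by case: (hW p).
have [||||||phi [N [cphi phiB oN AN lphi]]] :=
    @adapted_primitives K X compactX A W e.
- by move=> p; case: (hW p).
- by move=> p; case: (hW p).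
- move=> p q r x px qx rx; rewrite /e.
  have := coef_cocycle (cU p) (cU q) (cU r) I (WU _ _ px) (WU _ _ qx) (WU _ _ rx).
  by lra.
- move=> p q x px qx; have := near_coef (cU p) (cU q) (WU _ _ px) (WU _ _ qx).
  by apply: filterS => y; rewrite /e => ->.
- by move=> p q x Ap Aq px qx; rewrite /e cb// subrr.
- exact: WA.
by exists W, U, b, phi, N.
Qed.

End AdaptedPotentials.

Section LyapunovForm.
Context {K : realType} {X : metricType K} (Phi : X * K -> X).
Hypotheses (flowPhi : is_flow Phi) (compactX : compact [set: X]).
Let R := chain_recurrent_set Phi.
Variables (c : cech_cocycle K [set: X]) (W U : X -> set X) (b : X -> K).
Variables (phi : X -> X -> K) (N : set X).
Hypotheses
  (hW : forall p, [/\ open (W p), W p p, cech_cover c (U p) & W p `<=` U p])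
  (cphi : forall p x, W p x -> {for x, continuous (phi p)})
  (phiB : forall p q x, W p x -> W q x ->
    phi q x - phi p x = coef c (U p) (U q) x - (b q - b p))
  (oN : open N) (RN : R `<=` N)
  (lphi : forall p x, N x -> W p x -> \forall y \near x, phi p y = phi p x).

Let oW p : open (W p). Proof. by case: (hW p). Qed.
Let cU p : cech_cover c (U p). Proof. by case: (hW p). Qed.
Let WU p : W p `<=` U p. Proof. by case: (hW p). Qed.

(** The domain on which a function controlled only on [V] can be averaged over time [h]. *)
Definition orbit_core (h : K) (V : set X) : set X :=
  [set x | forall s, 0 <= s <= h -> V (Phi (x, s))].

Lemma open_orbit_core h V : open V -> open (orbit_core h V).
Proof. by move=> oV; rewrite openE => x /(near_orbit_sub flowPhi oV). Qed.

Lemma orbit_core_sub h V : 0 < h -> orbit_core h V `<=` V.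
Proof.
move=> h0 x /(_ 0); rewrite (flow0 flowPhi) lexx ltW//; exact.
Qed.

(** Continuity of [Phi] at [(x, 0)] gives a short time that works near [x]; compactness of the space
    gives a common one. *)
Lemma orbit_core_cover : exists2 h : K, 0 < h &
  forall x, exists p, orbit_core h (W p) x.
Proof.
pose P (h : K) x := exists p, orbit_core h (W p) x.
have cov := (compact_near_coveringP _).1 compactX K (0^'+) P _.
have {cov} : \forall h \near 0^'+, [set: X] `<=` P h.
  apply: cov => x _; have Wx : W x (Phi (x, 0)).
    by rewrite (flow0 flowPhi); case: (hW x).
  have [[B C] /= [nB nC] BC] :=
    flow_continuous flowPhi (open_nbhs_nbhs (conj (@oW x) Wx)).
  have [e /= e0 eC] := (nbhs_ballP _ _).1 nC.
  exists (B, [set h | h < e]) => /=.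
    by split=> //; exact: nbhs_right_lt.
  move=> [y h] /= [By he]; exists x => s /andP[s0 sh].
  apply: (BC (y, s)); split=> //=; apply: eC.
  by rewrite /ball /= sub0r normrN ger0_norm//; lra.
move=> cov; have : \forall h \near 0^'+, ([set: X] `<=` P h) /\ 0 < h.
  exact: filterI cov (nbhs_right_gt 0).
move=> /(@filter_ex _ _ (at_right_proper_filter (0 : K)))[h [hP h0]].
by exists h => // x; exact: hP.
Qed.

Let orbit_segment x h : set X := (fun t => Phi (x, t)) @` `[0, h].

Let segment0 x h : 0 < h -> orbit_segment x h x.
Proof. by exists 0; rewrite ?(flow0 flowPhi)//= in_itv /= lexx ltW. Qed.

Let segmentP x h s : 0 <= s <= h -> orbit_segment x h (Phi (x, s)).
Proof. by move=> sh; exists s. Qed.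

Let segment_core x h V : orbit_core h V x -> orbit_segment x h `<=` V.
Proof. by move=> xV _ [s sh <-]; exact: xV. Qed.

Section Step.
Variables (h : K) (h0 : 0 < h).

(** The orbit segment is connected and lies in [U p] and [U q], so the coefficient is constant along
    it. *)
Let phiB_orbit p q x s : orbit_core h (W p) x -> orbit_core h (W q) x ->
  0 <= s <= h ->
  phi q (Phi (x, s)) - phi p (Phi (x, s)) = coef c (U p) (U q) x - (b q - b p).
Proof.
move=> px qx sh; rewrite phiB; [|exact: px|exact: qx].
congr (_ - _); apply: (@coef_connected _ _ _ _ _ (orbit_segment x h)) => //.
- exact: orbit_connected.
- by move=> y /(segment_core px)/WU.
- by move=> y /(segment_core qx)/WU.
- exact: segment0.
- exact: segmentP.
Qed.

Let phi_core p x s : orbit_core h N x -> orbit_core h (W p) x -> 0 <= s <= h ->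
  phi p (Phi (x, s)) = phi p x.
Proof.
move=> Nx px sh.
apply: (@locally_constant_connected _ _ (orbit_segment x h)).
- exact: orbit_connected.
- move=> y ys; rewrite near_withinE.
  have := lphi (segment_core Nx ys) (segment_core px ys).
  by apply: filterS => z.
- exact: segment0.
- exact: segmentP.
Qed.

Let core_recurrent x : R x -> orbit_core h N x.
Proof. by move=> Rx s _; exact/RN/chain_recurrent_flow. Qed.

Let hh : 0 <= h <= h. Proof. by rewrite lexx ltW. Qed.

(** Near a point of [R] the increment of [phi p] is zero, so any positive [l] serves; near any other
    point [L] gains a definite amount, and large [l] serve. Compactness along the filter [+oo] gives
    one [l]. *)
Lemma dominating_factor (L : X -> K) : continuous L ->
  (forall z, ~ R z -> L z < L (Phi (z, h))) ->
  (forall x, exists p, orbit_core h (W p) x) ->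
  exists l : K, forall x p, ~ R x -> orbit_core h (W p) x ->
    phi p (Phi (x, h)) - phi p x < l * (L (Phi (x, h)) - L x).
Proof.
move=> cL sL covW.
pose P (l : K) x := forall p, ~ R x -> orbit_core h (W p) x ->
    phi p (Phi (x, h)) - phi p x < l * (L (Phi (x, h)) - L x).
have cov := (compact_near_coveringP _).1 compactX K (+oo) P _.
suff : \forall l \near +oo, [set: X] `<=` P l.
  by move=> /filter_ex[l hl]; exists l => x p; exact: hl.
apply: cov => x _; have [Rx|nRx] := pselect (R x).
  have nN := open_nbhs_nbhs (conj (open_orbit_core h oN) (core_recurrent Rx)).
  exists (orbit_core h N, [set l | 0 < l]) => /=.
    by split=> //; exact: nbhs_pinfty_gt.
  move=> [y l] /= [Ny l0] p nRy py.
  by rewrite phi_core// subrr mulr_gt0// subr_gt0; exact: sL.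
have [q qx] := covW x.
have cJ : {for x, continuous (fun y => phi q (Phi (y, h)) - phi q y)}.
  apply: cvgB; last by apply: cphi; exact: orbit_core_sub qx.
  apply: (@continuous_comp _ _ _ (fun y => Phi (y, h)) (phi q)).
    exact: flow_continuousl.
  by apply: cphi; exact: qx.
have cD : {for x, continuous (fun y => L (Phi (y, h)) - L y)}.
  apply: cvgB; last exact: cL.
  by apply: (@continuous_comp _ _ _ (fun y => Phi (y, h)) L);
    [exact: flow_continuousl|exact: cL].
have Dx : 0 < (L (Phi (x, h)) - L x) / 2.
  by have := sL x nRx; lra.
set D := (_ / 2) in Dx.
pose M := `|phi q (Phi (x, h)) - phi q x| + 1.
have M0 : 0 < M by rewrite ltr_wpDl.
have /cvgrPdist_lt/(_ _ ltr01) nJ := cJ.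
have /cvgrPdist_lt/(_ _ Dx) nD := cD.
have nq := open_nbhs_nbhs (conj (open_orbit_core h (@oW q)) qx).
pose A := [set y | orbit_core h (W q) y /\
  (`|phi q (Phi (x, h)) - phi q x - (phi q (Phi (y, h)) - phi q y)| < 1 /\
   `|L (Phi (x, h)) - L x - (L (Phi (y, h)) - L y)| < D)].
have nA : nbhs x A by apply: filterI nq (filterI nJ nD).
exists (A, [set l | M / D < l]) => /=.
  by split=> //; apply: nbhs_pinfty_gt; exact: num_real.
move=> [y l] /= [[qy [Jy Dy]]] Ml p nRy py.
have y0 : 0 <= (0 : K) <= h by rewrite lexx ltW.
(* The increments of [phi p] and [phi q] over the segment agree, so the bound found for [q] holds
   for every [p]. *)
have e1 := phiB_orbit py qy hh; have e2 := phiB_orbit py qy y0.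
rewrite (flow0 flowPhi) in e2.
have JM : phi q (Phi (y, h)) - phi q y < M.
  have := ler_norm (phi q (Phi (x, h)) - phi q x).
  by move: Jy; rewrite /M ltr_norml; lra.
have DD : D < L (Phi (y, h)) - L y.
  by move: Dy; rewrite ltr_norml /D; lra.
have l0 : 0 < l by apply: lt_trans Ml; rewrite divr_gt0.
have : l * D < l * (L (Phi (y, h)) - L y) by rewrite ltr_pM2l.
by move: Ml; rewrite ltr_pdivrMr//; lra.
Qed.

Section Family.
Variables (L : X -> K) (l : K).
Hypotheses (cL : continuous L)
  (hl : forall x p, ~ R x -> orbit_core h (W p) x ->
    phi p (Phi (x, h)) - phi p x < l * (L (Phi (x, h)) - L x)).

Let g p x := phi p x - l * L x.
Let psi p := orbit_average Phi h (g p).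
Let f := orbit_average Phi h (fun x => - (l * L x)).

Let clL : continuous (fun x => - (l * L x)).
Proof. by move=> x; apply: cvgN; apply: cvgM; [exact: cvg_cst|exact: cL]. Qed.

Let cg p x : W p x -> {for x, continuous (g p)}.
Proof. by move=> px; apply: cvgD; [exact: cphi|exact: clL]. Qed.

Lemma average_continuous p x : orbit_core h (W p) x -> {for x, continuous (psi p)}.
Proof. by move=> px; exact: (orbit_average_continuous flowPhi h0 (@oW p) (@cg p) px). Qed.

(** The global term [l * L] cancels and the rest is constant along the segment, so averaging leaves
    the differences of the potentials, and thereby the class, unchanged. *)
Lemma averageB p q x : orbit_core h (W p) x -> orbit_core h (W q) x ->
  psi q x - psi p x = coef c (U p) (U q) x - (b q - b p).
Proof.
move=> px qx; apply/eqP; rewrite subr_eq addrC; apply/eqP.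
apply: (orbit_averageD flowPhi h0 (@cg p) px) => s sh.
by rewrite /g -(phiB_orbit px qx sh); ring.
Qed.

Lemma average_lt p x t : ~ R x -> 0 < t ->
  (forall s, 0 <= s <= t -> orbit_core h (W p) (Phi (x, s))) ->
  psi p (Phi (x, t)) < psi p x.
Proof.
move=> nRx t0 xp; apply: (orbit_average_lt flowPhi h0 t0 (@cg p)) => s /andP[s0 st].
  (* Times up to [t] are base points of segments in [W p]; the later ones lie on the segment that
     starts at [Phi (x, t)]. *)
  have [sle|/ltW tle] := leP s t.
    by apply: orbit_core_sub (xp s _) => //; rewrite s0.
  have tt : 0 <= t <= t by rewrite lexx ltW.
  have := xp t tt (s - t); rewrite (flowD flowPhi) subrKC; apply.
  by rewrite subr_ge0 tle lerBlDl.
have st' : 0 <= s <= t by rewrite s0.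
have := hl (not_chain_recurrent_flow flowPhi compactX (t := s) nRx) (xp s st').
by rewrite (flowD flowPhi) /g; lra.
Qed.

(** [phi p] is constant along the segment. As it is also locally constant on [N], the form is the
    differential of [f] near [R]. *)
Lemma average_near_recurrent p x : orbit_core h N x -> orbit_core h (W p) x ->
  psi p x = f x + phi p x.
Proof.
move=> Nx px; have cT y : setT y -> {for y, continuous (fun x => - (l * L x))}.
  by move=> _; exact: clL.
apply: (orbit_averageD flowPhi h0 cT) => // s sh.
by rewrite /g (phi_core Nx px sh) addrC.
Qed.

Hypothesis covW : forall x, exists p, orbit_core h (W p) x.
Hypothesis constL : forall C, C `<=` R -> connected C ->
  forall y z, C y -> C z -> L y = L z.

(** An orbit segment in [R] is connected, so [L] is constant on it and averaging returns
    [- (l * L)], which [constL] controls. *)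
Lemma average_component x y : connected_component R x y -> f x = f y.
Proof.
have fR z : R z -> f z = - (l * L z).
  move=> Rz; apply: orbit_average_cst => // s sh; congr (- (_ * _)).
  have sub : orbit_segment z h `<=` R by exact: orbit_chain_recurrent.
  apply: (constL sub); first exact: orbit_connected.
    exact: segmentP.
  exact: segment0.
move=> [C [Cx CR cC] Cy].
by rewrite !fR ?(constL CR cC Cx Cy)//; exact: CR.
Qed.

Lemma lyapunov_family : exists F : form_family K [set: X],
  cohomologous (family_cocycle F) c /\
  lyapunov_form Phi R (\pi_(closed_form K [set: X]) F)%qT.
Proof.
have oO p : open (orbit_core h (W p)) by exact: open_orbit_core.
have [|F hF] := indexed_form_family oO covW (@average_continuous).
  move=> p q x px qx; have Upx := WU (orbit_core_sub h0 px).
  have Uqx := WU (orbit_core_sub h0 qx).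
  have np := open_nbhs_nbhs (conj (oO p) px).
  have nq := open_nbhs_nbhs (conj (oO q) qx).
  have := near_coef (@cU q) (@cU p) Uqx Upx.
  by apply: filterS3 np nq => y py qy; rewrite !averageB// => ->.
exists F; split; [|split].
(* The cover of [F] refines both cocycles, by the identity and by [U p]; the 0-cochain [- b p]
   accounts for the term in [averageB]. *)
- have /choice[t ht] : forall Z, exists t : set X * K, form_cover F Z ->
      exists p, [/\ Z = orbit_core h (W p), pot F Z = psi p, t.1 = U p & t.2 = - b p].
    move=> Z; have [FZ|nFZ] := pselect (form_cover F Z); last by exists (set0, 0).
    by have [p [eZ pZ]] := hF Z FZ; exists (U p, - b p) => _; exists p.
  exists (form_cover F), id, (fun Z => (t Z).1), (fun Z _ => (t Z).2); split.
  + exact: form_coverP.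
  + by move=> Z FZ; split=> // x [].
  + move=> Z /ht[p [eZ _ -> _]]; split; first exact: cU.
    by move=> x [_]; rewrite eZ => /(orbit_core_sub h0)/WU.
  + by move=> Z _; exact: locally_constant_cst.
  + move=> Z Z' x /ht[p [eZ pZ -> ->]] /ht[q [eZ' pZ' -> ->]] _ /=.
    rewrite pZ pZ' {1}eZ {1}eZ' => px qx.
    by rewrite averageB//; ring.
- move=> x t nRx t0.
  have cx : {within `[0, t], continuous (fun s => Phi (x, s))}.
    by apply: continuous_subspaceT; exact: flow_continuousr.
  have [v hv] := line_integral_exists F (ltW t0) cx.
  rewrite (line_integralE cx hv).
  (* The empty subdivision has integral 0, so the induction carries the weak inequality along with
     the strict one. *)
  suff [_ +] : v <= 0 /\ (0 < t -> v < 0) by exact.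
  apply: (is_line_integral_ind (P := fun a v => v <= 0 /\ (a < t -> v < 0))
    _ _ hv) => [|a d Z u /andP[ad dt] /hF[p [eZ ->]] sub _ [u0 _]].
    by rewrite lexx ltxx.
  suff : psi p (Phi (x, d)) - psi p (Phi (x, a)) < 0.
    by move=> ?; split=> [|_]; lra.
  rewrite subr_lt0 -[d](subrKC a) -(flowD flowPhi).
  apply: average_lt; first exact: not_chain_recurrent_flow.
    by rewrite subr_gt0.
  move=> s /andP[s0 sd]; rewrite -eZ (flowD flowPhi); apply: sub.
  by exists (a + s) => //=; rewrite in_itv/= lerDl s0 -lerBrDl.
have cf : continuous f.
  move=> x; apply: (orbit_average_continuous flowPhi h0 openT) => // y _.
  exact: clL.
exists (orbit_core h N), f, (continuous_subspaceT cf); split.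
- exact: open_orbit_core.
- exact: core_recurrent.
- rewrite form_restr_pi; apply/closed_form_eqP => Z V /hF[p [eZ pZ]] _ x.
  move=> [[Nx Zx] _]; rewrite near_withinE /= pZ.
  rewrite eZ in Zx *; rewrite (average_near_recurrent Nx Zx).
  have := lphi (orbit_core_sub h0 Nx) (orbit_core_sub h0 Zx).
  apply: filterS => y ey [[Ny py] _].
  by rewrite (average_near_recurrent Ny py) ey; ring.
- exact: average_component.
Qed.

End Family.
End Step.
End LyapunovForm.

Theorem corollary1 (K : realType) (X : metricType K) (Phi : X * K -> X)
  (flowPhi : is_flow Phi) (compactX : compact [set: X])
  (lpcX : locally_path_connected K X) (xi : cech_H1 K [set: X]) :
  cech_restr (@subsetT _ (chain_recurrent_set Phi)) xi =
    cech_zero K (chain_recurrent_set Phi) ->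
  exists w : closed_form K [set: X],
    connecting w = xi /\ lyapunov_form Phi (chain_recurrent_set Phi) w.
Proof.
rewrite -[xi]reprK; set c := repr xi => xiR.
have closedR := closed_chain_recurrent_set flowPhi compactX.
have [W [U [b [phi [N [hW cphi phiB [oN RN] lphi]]]]]] :=
  adapted_potentials compactX lpcX closedR xiR.
(* The order matters: [L] depends on the time step [h], and [l] on both. *)
have [h h0 covW] := orbit_core_cover flowPhi compactX hW.
have [L [cL _ sL constL]] := conley_function flowPhi compactX h0.
have [l hl] := dominating_factor flowPhi compactX hW cphi phiB oN RN lphi h0 cL sL covW.
have [F [Fc lyapF]] :=
  lyapunov_family flowPhi compactX hW cphi phiB oN RN lphi h0 cL hl covW constL.
exists (\pi_(closed_form K [set: X]) F)%qT; split=> //.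
by rewrite connecting_pi; apply/cech_H1_eqP.
Qed.
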